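(* The following is provable in $\mathbf{ZF}$ (no form of the Axiom of Choice is assumed). Let $\mathbf{X}=\langle X,\mu\rangle$ be a generalized topological space. Then, for every pair $A,B$ of non-empty subsets of $X$, the following conditions are equivalent: (a) there exists a $\langle\mu,\tau_n\rangle$-continuous function $f:X\to\mathbb{R}$ such that $A\subseteq f^{-1}[\{0\}]$ and $B\subseteq f^{-1}[\{1\}]$; (b) there exists a family of ordered pairs $\{\langle U_r,F_r\rangle: r\in\mathbb{Q}\cap(0,1)\}$ which satisfies the following conditions: (i) for every $r\in\mathbb{Q}\cap(0,1)$, $U_r$ is a $\mu$-open set, $F_r$ is a $\mu$-closed set and $A\subseteq U_r\subseteq F_r$; (ii) for every pair $s,r\in\mathbb{Q}\cap(0,1)$, if $s<r$, then $F_s\subseteq U_r$ and $U_r\setminus F_s\in\mu$; (iii) for every $r\in\mathbb{Q}\cap(0,1)$, $F_r\cap B=\emptyset$.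
   Context: A generalized topology in a set $X$ is a collection $\mu$ of subsets of $X$ closed under arbitrary unions (so $\emptyset\in\mu$, but $X\in\mu$ is not required, nor is closure under finite intersections). A generalized topological space is a pair $\mathbf{X}=\langle X,\mu\rangle$ with $\mu$ a generalized topology in $X$. A set $A\subseteq X$ is $\mu$-open if $A\in\mu$ and $\mu$-closed if $X\setminus A\in\mu$. $\tau_n$ is the usual topology of $\mathbb{R}$. A map $f:X\to\mathbb{R}$ is $\langle\mu,\tau_n\rangle$-continuous if $f^{-1}[V]\in\mu$ for every $V\in\tau_n$. *)

(* Defs.v *)
From mathcomp Require Import all_boot all_order all_algebra.
From mathcomp Require Import all_classical all_reals all_analysis.
Set Implicit Arguments.
Unset Strict Implicit.
Unset Printing Implicit Defensive.
Import Order.TTheory GRing.Theory Num.Theory.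
Import numFieldNormedType.Exports.

Local Open Scope classical_set_scope.

(* The union of the empty family is [set0], hence [mu set0]; [mu setT] is not
   required. *)
Definition generalized_topology (X : Type) (mu : set (set X)) : Prop :=
  forall S : set (set X), S `<=` mu -> mu (\bigcup_(U in S) U).

Definition gclosed (X : Type) (mu : set (set X)) (F : set X) : Prop :=
  mu (~` F).

Definition gcontinuous (R : realType) (X : Type) (mu : set (set X))
    (f : X -> R) : Prop :=
  forall V : set R, open V -> mu (f @^-1` V).

Local Close Scope classical_set_scope.

(* The language has no function symbols, so terms are variables, given as
   de Bruijn indices; substitutions are renamings. *)
Inductive fo_form : Type :=
| FFalse
| FEq (i j : nat)
| FMem (i j : nat)
| FImp (p q : fo_form)
| FAll (p : fo_form).

Definition scons (i : nat) (xi : nat -> nat) (n : nat) : nat :=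
  if n is m.+1 then xi m else i.

Fixpoint ren (xi : nat -> nat) (p : fo_form) : fo_form :=
  match p with
  | FFalse => FFalse
  | FEq i j => FEq (xi i) (xi j)
  | FMem i j => FMem (xi i) (xi j)
  | FImp p q => FImp (ren xi p) (ren xi q)
  | FAll p => FAll (ren (scons 0 (fun n => (xi n).+1)) p)
  end.

(* Classical natural deduction with equality, from the theory [T]. Unlike
   the hypotheses in [G], axioms of [T] are available under [der_all_intro]
   without being shifted, so the free variables of an axiom are read as
   universally quantified. *)
Inductive derives (T : fo_form -> Prop) : seq fo_form -> fo_form -> Prop :=
| der_axiom G p : T p -> derives T G p
| der_hyp G1 G2 p : derives T (G1 ++ p :: G2) p
| der_imp_intro G p q : derives T (p :: G) q -> derives T G (FImp p q)
| der_imp_elim G p q :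
    derives T G (FImp p q) -> derives T G p -> derives T G q
| der_raa G p : derives T (FImp p FFalse :: G) FFalse -> derives T G p
| der_all_intro G p : derives T (map (ren S) G) p -> derives T G (FAll p)
| der_all_elim G p i :
    derives T G (FAll p) -> derives T G (ren (scons i id) p)
| der_eq_refl G i : derives T G (FEq i i)
| der_eq_subst G p i j :
    derives T G (FEq i j) -> derives T G (ren (scons i id) p) ->
    derives T G (ren (scons j id) p).

(* An [expr] is a formula that still has to be told the number [d] of
   quantifiers above it. A variable bound by [xall] is represented by the
   number of quantifiers above its binder (its de Bruijn level), so it can be
   used unchanged at any depth; its index at depth [d] is [d - x.+1]. *)
Definition expr := nat -> fo_form.

Declare Scope zf_scope.
Delimit Scope zf_scope with zf.
Bind Scope zf_scope with expr.

Definition xeq (x y : nat) : expr := fun d => FEq (d - x.+1) (d - y.+1).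
Definition xmem (x y : nat) : expr := fun d => FMem (d - x.+1) (d - y.+1).
Definition xfalse : expr := fun=> FFalse.
Definition ximp (p q : expr) : expr := fun d => FImp (p d) (q d).
Definition xall (p : nat -> expr) : expr := fun d => FAll (p d d.+1).
Definition xnot (p : expr) : expr := ximp p xfalse.
Definition xand (p q : expr) : expr := xnot (ximp p (xnot q)).
Definition xor (p q : expr) : expr := ximp (xnot p) q.
Definition xiff (p q : expr) : expr := xand (ximp p q) (ximp q p).
Definition xex (p : nat -> expr) : expr := xnot (xall (fun x => xnot (p x))).
Definition xall_in (a : nat) (p : nat -> expr) : expr :=
  xall (fun x => ximp (xmem x a) (p x)).
Definition xex_in (a : nat) (p : nat -> expr) : expr :=
  xex (fun x => xand (xmem x a) (p x)).

Notation "x = y" := (xeq x y) : zf_scope.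
Notation "x \in y" := (xmem x y) : zf_scope.
Notation "~ p" := (xnot p) : zf_scope.
Notation "p /\ q" := (xand p q) : zf_scope.
Notation "p \/ q" := (xor p q) : zf_scope.
Notation "p -> q" := (ximp p q) : zf_scope.
Notation "p <-> q" := (xiff p q) : zf_scope.
Notation "'All' x .. y , p" := (xall (fun x => .. (xall (fun y => p)) ..))
  (at level 200, x binder, y binder, right associativity,
   format "'[  ' 'All'  x  ..  y ,  '/' p ']'") : zf_scope.
Notation "'Ex' x .. y , p" := (xex (fun x => .. (xex (fun y => p)) ..))
  (at level 200, x binder, y binder, right associativity,
   format "'[  ' 'Ex'  x  ..  y ,  '/' p ']'") : zf_scope.
Notation "'AllIn' a 'of' x .. y , p" :=
  (xall_in a (fun x => .. (xall_in a (fun y => p)) ..))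
  (at level 200, a at level 0, x binder, y binder, right associativity,
   format "'[  ' 'AllIn'  a  'of'  x  ..  y ,  '/' p ']'") : zf_scope.
Notation "'ExIn' a 'of' x .. y , p" :=
  (xex_in a (fun x => .. (xex_in a (fun y => p)) ..))
  (at level 200, a at level 0, x binder, y binder, right associativity,
   format "'[  ' 'ExIn'  a  'of'  x  ..  y ,  '/' p ']'") : zf_scope.

Local Open Scope zf_scope.

Definition xex_unique (p : nat -> expr) : expr :=
  Ex x, p x /\ (All y, p y -> y = x).

(* [xapp phi s] is [phi] with its first variables instantiated by the bound
   variables [s]; the remaining free variables of [phi] become free
   variables (parameters) of the whole formula. *)
Definition xapp (phi : fo_form) (s : seq nat) : expr := fun d =>
  ren (fun n => if (n < size s)%N then (d - (nth 0 s n).+1)%N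
                else (d + (n - size s))%N) phi.

Definition close (p : expr) : fo_form := p 0.

Definition subs (a b : nat) : expr := AllIn a of x, x \in b.

Inductive ZF : fo_form -> Prop :=
| ZF_extensionality :
    ZF (close (All a b, (All x, x \in a <-> x \in b) -> a = b))
| ZF_foundation :
    ZF (close (All a, (Ex x, x \in a) ->
      ExIn a of x, ~ (Ex y, y \in x /\ y \in a)))
| ZF_pairing :
    ZF (close (All a b, Ex c, All x, x \in c <-> (x = a \/ x = b)))
| ZF_union :
    ZF (close (All a, Ex u, All x, x \in u <-> (ExIn a of y, x \in y)))
| ZF_powerset :
    ZF (close (All a, Ex p, All x, x \in p <-> subs x a))
| ZF_infinity :
    ZF (close (Ex i, (ExIn i of e, All x, ~ (x \in e)) /\
      (AllIn i of x, ExIn i of y, All z, z \in y <-> (z \in x \/ z = x))))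
| ZF_separation (phi : fo_form) :
    ZF (close (All a, Ex b, All x,
      x \in b <-> (x \in a /\ xapp phi [:: x])))
| ZF_replacement (phi : fo_form) :
    ZF (close (All a,
      (AllIn a of x, All y z,
        xapp phi [:: x; y] -> xapp phi [:: x; z] -> y = z) ->
      Ex b, All y, y \in b <-> (ExIn a of x, xapp phi [:: x; y]))).

(* Neither Choice nor any fragment of it is among the axioms [ZF]. *)
Definition ZF_proves (p : expr) : Prop := derives ZF [::] (close p).

Definition is_inhabited (a : nat) : expr := Ex x, x \in a.

Definition are_disjoint (a b : nat) : expr := ~ (Ex x, x \in a /\ x \in b).

(* c = a \ b *)
Definition is_setdiff (c a b : nat) : expr :=
  All x, x \in c <-> (x \in a /\ ~ (x \in b)).

(* u is the union of the family S *)
Definition is_union (u S : nat) : expr :=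
  All x, x \in u <-> (ExIn S of a, x \in a).

(* c = {a, b} *)
Definition is_upair (c a b : nat) : expr :=
  All x, x \in c <-> (x = a \/ x = b).

(* p = <a, b> = {{a}, {a, b}} *)
Definition is_pair (p a b : nat) : expr :=
  Ex s t, is_upair s a a /\ is_upair t a b /\ is_upair p s t.

(* <a, b> is an element of f; when f is a function this says f(a) = b *)
Definition maps (f a b : nat) : expr := Ex p, is_pair p a b /\ p \in f.

Definition is_function_on (f D : nat) : expr :=
  (AllIn f of p, ExIn D of x, Ex y, is_pair p x y) /\
  (AllIn D of x, xex_unique (fun y => maps f x y)).

Definition is_function (f D C : nat) : expr :=
  is_function_on f D /\ (AllIn D of x, All y, maps f x y -> y \in C).

(* P is the preimage of V under f *)
Definition is_preimage (P f V : nat) : expr :=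
  All x, x \in P <-> (ExIn V of y, maps f x y).

(* A is contained in the preimage of {c} under f *)
Definition subs_fiber (A f c : nat) : expr :=
  Ex V P, is_upair V c c /\ is_preimage P f V /\ subs A P.

(* <<x, y>, z> is an element of op, that is, x op y = z *)
Definition opr (op x y z : nat) : expr := Ex p, is_pair p x y /\ maps op p z.

Definition is_binop (op R : nat) : expr :=
  (AllIn op of q, ExIn R of x y z, Ex p, is_pair p x y /\ is_pair q p z) /\
  (AllIn R of x y, xex_unique (fun z => opr op x y z)).

Definition is_comm_assoc (op R : nat) : expr :=
  (AllIn R of x y z, opr op x y z -> opr op y x z) /\
  (AllIn R of x y z, AllIn R of u v w,
    opr op x y u -> opr op u z w -> opr op y z v -> opr op x v w).

Definition is_field (R pl ml o e : nat) : expr :=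
  is_binop pl R /\ is_binop ml R /\
  is_comm_assoc pl R /\ is_comm_assoc ml R /\
  o \in R /\ e \in R /\ ~ (o = e) /\
  (AllIn R of x, opr pl x o x) /\
  (AllIn R of x, opr ml x e x) /\
  (AllIn R of x, ExIn R of y, opr pl x y o) /\
  (AllIn R of x, ~ (x = o) -> ExIn R of y, opr ml x y e) /\
  (AllIn R of x y z, AllIn R of s t u v,
    opr pl y z s -> opr ml x s t -> opr ml x y u -> opr ml x z v ->
    opr pl u v t).

(* the set of pairs lt is a strict total order compatible with pl and ml;
   [maps lt x y] reads x < y *)
Definition is_field_order (R pl ml o lt : nat) : expr :=
  (AllIn lt of p, ExIn R of x y, is_pair p x y) /\
  (AllIn R of x, ~ maps lt x x) /\
  (AllIn R of x y z, maps lt x y -> maps lt y z -> maps lt x z) /\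
  (AllIn R of x y, maps lt x y \/ x = y \/ maps lt y x) /\
  (AllIn R of x y z, AllIn R of u v,
    maps lt x y -> opr pl x z u -> opr pl y z v -> maps lt u v) /\
  (AllIn R of x y z,
    maps lt o x -> maps lt o y -> opr ml x y z -> maps lt o z).

Definition is_le (lt x y : nat) : expr := maps lt x y \/ x = y.

Definition is_upper_bound (lt S x : nat) : expr := AllIn S of y, is_le lt y x.

Definition is_complete (R lt : nat) : expr :=
  All S, subs S R -> is_inhabited S -> (ExIn R of x, is_upper_bound lt S x) ->
  ExIn R of x, is_upper_bound lt S x /\
    (AllIn R of y, is_upper_bound lt S y -> is_le lt x y).

(* The field of real numbers is the Dedekind complete ordered field, which is
   unique up to isomorphism. *)
Definition is_reals (R pl ml o e lt : nat) : expr :=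
  is_field R pl ml o e /\ is_field_order R pl ml o lt /\ is_complete R lt.

Definition is_subfield (K R pl ml o e : nat) : expr :=
  subs K R /\ o \in K /\ e \in K /\
  (AllIn K of x y, All z, opr pl x y z -> z \in K) /\
  (AllIn K of x y, All z, opr ml x y z -> z \in K) /\
  (AllIn K of x, AllIn R of y, opr pl x y o -> y \in K) /\
  (AllIn K of x, AllIn R of y, opr ml x y e -> y \in K).

(* Q is the least subfield of R, that is, the rational numbers *)
Definition is_rationals (Q R pl ml o e : nat) : expr :=
  is_subfield Q R pl ml o e /\
  (All K, is_subfield K R pl ml o e -> subs Q K).

(* I = Q \cap (0, 1) *)
Definition is_rational_unit_interval (I Q lt o e : nat) : expr :=
  All r, r \in I <-> (r \in Q /\ maps lt o r /\ maps lt r e).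

(* tau is the order topology of R, that is, its usual topology *)
Definition is_usual_topology (tau R lt : nat) : expr :=
  All V, V \in tau <-> (subs V R /\
    (AllIn V of x, ExIn R of a b, maps lt a x /\ maps lt x b /\
      (AllIn R of y, maps lt a y -> maps lt y b -> y \in V))).

Definition is_gtopology (mu X : nat) : expr :=
  (AllIn mu of U, subs U X) /\
  (All S, subs S mu -> ExIn mu of U, is_union U S).

Definition is_gclosed (F mu X : nat) : expr :=
  subs F X /\ (ExIn mu of C, is_setdiff C X F).

Definition is_continuous (f mu tau : nat) : expr :=
  AllIn tau of V, ExIn mu of P, is_preimage P f V.

(* the value of the family G at r is the ordered pair <U, F> *)
Definition maps_pair (G r U F : nat) : expr :=
  Ex v, is_pair v U F /\ maps G r v.

(* Main.v *)
From HB Require Import structures.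
From Stdlib Require List.
Require Import Defs.
From mathcomp Require Import all_boot all_order all_algebra.
From mathcomp Require Import all_classical all_reals all_analysis.
From mathcomp Require Import lra.
Import Order.TTheory GRing.Theory Num.Theory.
Import numFieldNormedType.Exports.
Set Implicit Arguments.
Unset Strict Implicit.
Unset Printing Implicit Defensive.

(** Why the theorem is true.

    A function [f] yields the open sets [U_r = {f < r}], the closed sets
    [F_r = {f <= r}] and the open differences [U_r \ F_s = {s < f < r}].
    Conversely, a family gives [f x], the supremum of [0] and of the indices
    [s] with [x] outside [F_s]. Density of the indices and the inclusions
    [F_s <= U_r] for [s < r] show that [f <= r] on [U_r], that [s <= f] off
    [F_s], and that [x] lies in [U_r] when [f x < r] and off [F_s] when
    [s < f x]. Hence every point where [a < f < b] has one of [U_r],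
    the complement of [F_s] and [U_r \ F_s] as a neighbourhood on which
    [a < f < b] holds ([scale_nbhs]). A generalized topology is closed under
    unions only, so it matters that the difference is a single member of it
    and not an intersection of two. The preimage of an open set is the union
    of all members of the generalized topology that it contains; nothing is
    chosen.

    That ZF alone proves the equivalence is a statement about derivations,
    and it is obtained from Goedel's completeness theorem: a formula true
    in every structure that satisfies the axioms is derivable
    ([completeness]). The proof is Henkin's. A formula that is not derivable
    has its negation extended, one formula of an enumeration at a time, to a
    maximal consistent set with witnesses; every stage is a finite list, so
    that some variable is fresh for it and free variables can serve as
    witnesses. Variables modulo provable equality form the model. The choice
    principles of the ambient logic are used to build this model, while the
    derivation so obtained uses the axioms of ZF and no others.

    It remains to carry out the argument above in an arbitrary model
    [(M, E)] of ZF, whose reals, rationals and subsets are those of the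
    model only. A set or a function needed there must come from separation
    or replacement for a formula; [separation], [replacement] and
    [function_ex] accept a predicate on [M] together with a formula that
    means it, and the tactic [solve_means] finds the formula by recursion on
    the predicate. The object that the model takes for its field of reals
    is turned into a [realFieldType] ([reals_coordinates]). It need not be
    archimedean from outside, and it has suprema only for sets of the model;
    that is enough to make its rationals dense ([subfield_dense]), and
    [scale_nbhs] then applies to it as it does to the real numbers. *)

(** * Renamings and free variables *)

Definition up (xi : nat -> nat) : nat -> nat := scons 0 (fun n => (xi n).+1).

Lemma ren_comp p xi zeta : ren xi (ren zeta p) = ren (xi \o zeta) p.
Proof.
elim: p xi zeta => //= [p IHp q IHq|p IHp] xi zeta; first by rewrite IHp IHq.
by rewrite IHp; congr (FAll (ren _ p)); apply/funext; case.
Qed.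

Lemma ren_id p : ren id p = p.
Proof.
elim: p => //= [p -> q -> //|p IHp].
by rewrite -[in RHS]IHp; congr (FAll (ren _ p)); apply/funext; case.
Qed.

Fixpoint fv_bound (p : fo_form) : nat :=
  match p with
  | FFalse => 0
  | FEq i j | FMem i j => maxn i.+1 j.+1
  | FImp p q => maxn (fv_bound p) (fv_bound q)
  | FAll p => (fv_bound p).-1
  end.

Lemma ren_agree p xi zeta :
  (forall n, n < fv_bound p -> xi n = zeta n) -> ren xi p = ren zeta p.
Proof.
elim: p xi zeta => //= [i j|i j|p IHp q IHq|p IHp] xi zeta agree.
- by rewrite !agree // leq_max ltnSn ?orbT.
- by rewrite !agree // leq_max ltnSn ?orbT.
- by congr FImp; [apply: IHp|apply: IHq] => n lt_n; apply: agree;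
    rewrite leq_max lt_n ?orbT.
- congr FAll; apply: IHp => -[//|n] lt_n /=; rewrite agree //.
  by case: (fv_bound p) lt_n.
Qed.

Lemma ren_fresh p xi : (forall n, n < fv_bound p -> xi n = n) -> ren xi p = p.
Proof. by move=> fix_xi; rewrite (ren_agree (zeta := id)) ?ren_id. Qed.

(** * Structural rules of natural deduction *)

Section Structural.
Variable T : fo_form -> Prop.

Lemma der_weak G G' p :
  derives T G p -> (forall q, List.In q G -> List.In q G') -> derives T G' p.
Proof.
move=> d; elim: d G' => {G p}.
- by move=> G p Tp G' _; apply: der_axiom.
- move=> G1 G2 p G' sub.
  have [|H1 [H2 ->]] := @List.in_split _ p G'; last exact: der_hyp.
  by apply: sub; apply/List.in_app_iff; right; left.
- move=> G p q _ IH G' sub; apply: der_imp_intro; apply: IH => r /= [->|Gr].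
    by left.
  by right; apply: sub.
- move=> G p q _ IH1 _ IH2 G' sub; apply: der_imp_elim (IH1 _ sub) (IH2 _ sub).
- move=> G p _ IH G' sub; apply: der_raa; apply: IH => r /= [->|Gr].
    by left.
  by right; apply: sub.
- move=> G p _ IH G' sub; apply: der_all_intro; apply: IH => r.
  by move=> /List.in_map_iff[q [<- Gq]]; apply: List.in_map; apply: sub.
- by move=> G p i _ IH G' sub; apply: der_all_elim (IH _ sub).
- by move=> G i G' _; apply: der_eq_refl.
- move=> G p i j _ IH1 _ IH2 G' sub.
  exact: der_eq_subst (IH1 _ sub) (IH2 _ sub).
Qed.

Lemma der_in G p : List.In p G -> derives T G p.
Proof. by move=> /(@List.in_split _ _ _)[G1 [G2 ->]]; apply: der_hyp. Qed.

Lemma der_cons G p q : derives T G p -> derives T (q :: G) p.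
Proof. by move=> d; apply: der_weak d _ => r; right. Qed.

Lemma der_false G p : derives T G FFalse -> derives T G p.
Proof. by move=> d; apply/der_raa/der_cons. Qed.

(** An axiom holds in every context, in particular in a context that has been
    shifted, so its free variables can be generalized one after the other. *)
Lemma der_close p : (forall G, derives T G p) ->
  forall N G, derives T G (iter N FAll p).
Proof.
by move=> d; elim=> [//|N IHN] G; apply: der_all_intro; apply: IHN.
Qed.

(** Eliminating the quantifiers outermost first instantiates the largest index
    first: at each step [s N] takes the place of variable [N], and the part of
    the renaming already performed accumulates in [xi]. *)
Lemma der_open N p G xi (s : nat -> nat) :
  derives T G (ren xi (iter N FAll p)) ->
  derives T G (ren (fun n => if n < N then s n else xi (n - N)) p).
Proof.
elim: N xi => [|N IHN] xi d.
  by rewrite (ren_agree (zeta := xi)) // => n _; rewrite subn0.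
have /= := der_all_elim (s N) d; rewrite ren_comp => /IHN.
congr (derives T G (ren _ p)); apply/funext => n; rewrite ltnS.
have [lt_nN|lt_Nn|->] := ltngtP n N; first by [].
  by rewrite -(subnSK lt_Nn).
by rewrite subnn.
Qed.

Lemma der_axiom_ren p G xi : T p -> derives T G (ren xi p).
Proof.
move=> Tp.
have closed : derives T G (ren id (iter (fv_bound p) FAll p)).
  by rewrite ren_id; apply: der_close => G'; apply: der_axiom.
have := der_open xi closed.
by rewrite (ren_agree (zeta := xi)) // => n ->.
Qed.

(** Derivability is stable under renaming. Only the axioms need an argument,
    for they are not assumed to be closed: [der_axiom_ren] generalizes their
    free variables and instantiates them again. *)
Lemma der_ren G p : derives T G p ->
  forall xi, derives T (map (ren xi) G) (ren xi p).
Proof.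
elim=> {G p} /=.
- by move=> G p Tp xi; apply: der_axiom_ren.
- by move=> G1 G2 p xi; rewrite map_cat; apply: der_hyp.
- by move=> G p q _ IH xi; apply: der_imp_intro; apply: IH.
- by move=> G p q _ IH1 _ IH2 xi; apply: der_imp_elim (IH1 _) (IH2 _).
- by move=> G p _ IH xi; apply: der_raa; apply: IH.
- move=> G p _ IH xi; apply: der_all_intro; rewrite -map_comp.
  have := IH (up xi); rewrite -map_comp.
  by congr (derives T _ _); apply: eq_map => q /=; rewrite !ren_comp.
- move=> G p i _ IH xi; have := der_all_elim (xi i) (IH xi).
  rewrite !ren_comp; congr (derives T _ (ren _ p)).
  by apply/funext; case.
- by move=> G i xi; apply: der_eq_refl.
- move=> G p i j _ IH1 _ IH2 xi.
  have swap k : ren xi (ren (scons k id) p) =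
      ren (scons (xi k) id) (ren (up xi) p).
    by rewrite !ren_comp; congr (ren _ p); apply/funext; case.
  rewrite swap; apply: der_eq_subst (IH1 xi) _.
  by rewrite -swap.
Qed.

(** Generalization over a named fresh variable [i]. The renaming that sends [i]
    to [0] and shifts every other variable turns the premise into the premise
    of [der_all_intro], because [i] does not occur in the context or in [p]. *)
Lemma der_all_fresh G p i :
  (forall q, List.In q (FAll p :: G) -> fv_bound q <= i) ->
  derives T G (ren (scons i id) p) -> derives T G (FAll p).
Proof.
move=> fresh d; apply: der_all_intro.
pose xi n := if n == i then 0 else n.+1.
have := der_ren d xi; rewrite ren_comp.
have -> : map (ren xi) G = map (ren S) G.
  apply/List.map_ext_in => q Gq; apply: ren_agree => n lt_n.
  have := fresh q (or_intror Gq) => le_i.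
  by rewrite /xi ltn_eqF // (leq_trans lt_n).
rewrite ren_fresh // => -[|n] lt_n /=; rewrite /xi ?eqxx //.
rewrite ltn_eqF //; apply: leq_trans (fresh (FAll p) (or_introl erefl)) => /=.
by case: (fv_bound p) lt_n.
Qed.

End Structural.

(** * Completeness of first-order logic with equality *)

Section Semantics.
Variables (M : Type) (E : M -> M -> Prop).

Definition push (a : M) (rho : nat -> M) (n : nat) : M :=
  if n is m.+1 then rho m else a.

Fixpoint sat (rho : nat -> M) (p : fo_form) : Prop :=
  match p with
  | FFalse => False
  | FEq i j => rho i = rho j
  | FMem i j => E (rho i) (rho j)
  | FImp p q => sat rho p -> sat rho q
  | FAll p => forall a, sat (push a rho) p
  end.

Lemma sat_ren p rho xi : sat rho (ren xi p) <-> sat (rho \o xi) p.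
Proof.
elim: p rho xi => //= [p IHp q IHq|p IHp] rho xi.
  by rewrite IHp IHq.
have comm a : push a rho \o scons 0 (fun n => (xi n).+1) = push a (rho \o xi).
  by apply/funext; case.
by split=> H a; have := H a; rewrite IHp comm.
Qed.

End Semantics.

Section FormulaEnumeration.
Import GenTree.

Fixpoint code (p : fo_form) : tree nat :=
  match p with
  | FFalse => Node 0 [::]
  | FEq i j => Node 1 [:: Leaf i; Leaf j]
  | FMem i j => Node 2 [:: Leaf i; Leaf j]
  | FImp p q => Node 3 [:: code p; code q]
  | FAll p => Node 4 [:: code p]
  end.

Fixpoint decode (t : tree nat) : fo_form :=
  match t with
  | Node 1 [:: Leaf i; Leaf j] => FEq i j
  | Node 2 [:: Leaf i; Leaf j] => FMem i j
  | Node 3 [:: t; u] => FImp (decode t) (decode u)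
  | Node 4 [:: t] => FAll (decode t)
  | _ => FFalse
  end.

Lemma codeK : cancel code decode.
Proof. by elim=> //= [p -> q ->|p ->]. Qed.

Definition form_enum (n : nat) : fo_form :=
  decode (odflt (Leaf 0) (unpickle n)).

Lemma form_enum_surj p : exists n, form_enum n = p.
Proof. by exists (pickle (code p)); rewrite /form_enum pickleK codeK. Qed.

End FormulaEnumeration.

Section Completeness.
Variables (T : fo_form -> Prop) (phi : fo_form).

Notation fnot p := (FImp p FFalse).

Definition cons_with (G : seq fo_form) : Prop := ~ derives T G FFalse.

Definition fresh_for (G : seq fo_form) : nat := foldr (maxn \o fv_bound) 0 G.

Lemma fresh_forP G q : List.In q G -> fv_bound q <= fresh_for G.
Proof.
elim: G => //= r G IHG [->|/IHG le_q]; first exact: leq_maxl.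
exact: leq_trans le_q (leq_maxr _ _).
Qed.

Definition witness (p : fo_form) (G : seq fo_form) : seq fo_form :=
  if p is FAll q
  then [:: fnot (ren (scons (fresh_for (p :: G)) id) q)] else [::].

(** A universal formula that is rejected gets its counterexample at once, while
    the context is finite and a fresh variable is at hand. *)
Definition extend (G : seq fo_form) (p : fo_form) : seq fo_form :=
  if `[< cons_with (p :: G) >] then p :: G
  else witness p (fnot p :: G) ++ fnot p :: G.

(** A fresh counterexample is harmless: if it were refutable, its instance would
    be derivable, hence by [der_all_fresh] the universal formula as well. *)
Lemma extend_cons G p : cons_with G -> cons_with (extend G p).
Proof.
move=> consG; rewrite /extend; case: asboolP => // /contrapT dp.
have dnp : derives T G (fnot p) by apply: der_imp_intro.
have consG' : cons_with (fnot p :: G).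
  by move=> d; apply: consG; apply: der_imp_elim (der_imp_intro d) dnp.
case: p dp dnp consG' => //= p dp dnp consG' d; apply: (consG').
apply: (der_imp_elim (p := FAll p)); first by apply: der_in; left.
by apply: der_all_fresh (der_raa d); apply: fresh_forP.
Qed.

Lemma extend_sub G p q : List.In q G -> List.In q (extend G p).
Proof.
rewrite /extend => Gq; case: ifP => _; first by right.
by apply/List.in_app_iff; right; right.
Qed.

Fixpoint stage (n : nat) : seq fo_form :=
  if n is m.+1 then extend (stage m) (form_enum m) else [:: fnot phi].

(** The maximal consistent set with witnesses that contains the negation of
    [phi]. *)
Definition Omega (p : fo_form) : Prop := exists n, List.In p (stage n).

Hypothesis unprovable : ~ derives T [::] phi.

Lemma stage_cons n : cons_with (stage n).
Proof.
elim: n => [|n IHn] /=; last exact: extend_cons.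
by move=> /der_raa.
Qed.

Lemma stage_sub m n q : m <= n -> List.In q (stage m) -> List.In q (stage n).
Proof.
move=> /subnK <-; elim: (n - m) => //= k IHk /IHk.
exact: extend_sub.
Qed.

Lemma Omega_decides p : exists n, List.In p (stage n) \/
  [/\ List.In (fnot p) (stage n) &
    if p is FAll q then exists i, List.In (fnot (ren (scons i id) q)) (stage n)
    else True].
Proof.
have [n en] := form_enum_surj p; exists n.+1 => /=; rewrite en /extend.
case: ifP => _; first by left; left.
right; split; first by apply/List.in_app_iff; right; left.
by case: p {en} => //= q; eexists; left.
Qed.

(** [Omega] is deductively closed, as it decides every formula and all its
    finite parts are consistent. *)
Lemma Omega_der n p : derives T (stage n) p -> Omega p.
Proof.
move=> d; have [m [?|[np _]]] := Omega_decides p; first by exists m.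
exfalso; apply: (@stage_cons (maxn m n)).
apply: (der_imp_elim (p := p)).
  by apply: der_in; apply: stage_sub np; apply: leq_maxl.
by apply: der_weak d _ => q; apply: stage_sub; apply: leq_maxr.
Qed.

Lemma Omega_der2 p q r : Omega p -> Omega q ->
  derives T [:: p; q] r -> Omega r.
Proof.
move=> [m Gp] [n Gq] d; apply: (@Omega_der (maxn m n)).
apply: der_weak d _ => s /= [<-|[<-|//]].
  by apply: stage_sub Gp; apply: leq_maxl.
by apply: stage_sub Gq; apply: leq_maxr.
Qed.

Lemma Omega_der1 p r : Omega p -> derives T [:: p] r -> Omega r.
Proof.
by move=> Op d; apply: (Omega_der2 Op (q := p)) => //; apply: der_cons.
Qed.

Lemma Omega_der0 r : derives T [::] r -> Omega r.
Proof. by move=> d; apply: (@Omega_der 0); apply: der_weak d _. Qed.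

Lemma Omega_false : ~ Omega FFalse.
Proof. by move=> [n /(der_in T)]; apply: stage_cons. Qed.

Lemma Omega_imp p q : Omega (FImp p q) <-> (Omega p -> Omega q).
Proof.
split=> [Opq Op|Opq].
  by apply: Omega_der2 Opq Op _; apply: (der_imp_elim (p := p));
    apply: der_in; [left|right; left].
have [n [Op|[np _]]] := Omega_decides p.
  have /Opq Oq : Omega p by exists n.
  by apply: Omega_der1 Oq _; apply: der_imp_intro; apply: der_in; right; left.
have Onp : Omega (fnot p) by exists n.
apply: Omega_der1 Onp _; apply: der_imp_intro; apply: der_false.
by apply: (der_imp_elim (p := p)); apply: der_in; [right; left|left].
Qed.

Lemma Omega_all p : Omega (FAll p) <-> forall i, Omega (ren (scons i id) p).
Proof.
split=> [Op i|Oinst].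
  by apply: Omega_der1 Op _; apply: der_all_elim; apply: der_in; left.
have [n [?|[_ [i np]]]] := Omega_decides (FAll p); first by exists n.
exfalso; apply: Omega_false; apply: (Omega_imp _ _).1 (Oinst i).
by exists n.
Qed.

Lemma Omega_eq_subst p i j : Omega (FEq i j) ->
  Omega (ren (scons i id) p) -> Omega (ren (scons j id) p).
Proof.
move=> Oe Op; apply: Omega_der2 Oe Op _; apply: der_eq_subst; apply: der_in.
  by left.
by right; left.
Qed.

Lemma Omega_eq_refl i : Omega (FEq i i).
Proof. exact/Omega_der0/der_eq_refl. Qed.

Lemma Omega_eq_sym i j : Omega (FEq i j) -> Omega (FEq j i).
Proof.
by move=> /(Omega_eq_subst (p := FEq 0 i.+1)); apply; apply: Omega_eq_refl.
Qed.

Lemma Omega_eq_trans i j k :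
  Omega (FEq i j) -> Omega (FEq j k) -> Omega (FEq i k).
Proof. by move=> Oij /(Omega_eq_subst (p := FEq i.+1 0)); apply. Qed.

Lemma Omega_mem_subst i i' j j' : Omega (FEq i i') -> Omega (FEq j j') ->
  Omega (FMem i j) -> Omega (FMem i' j').
Proof.
move=> /(Omega_eq_subst (p := FMem 0 j.+1)) /= Oi.
move=> /(Omega_eq_subst (p := FMem i'.+1 0)) /= Oj.
by move=> /Oi /Oj.
Qed.

Definition var_eq (i j : nat) : bool := `[< Omega (FEq i j) >].

Lemma var_eq_equiv : equiv_class_of var_eq.
Proof.
split=> [i|i j|j i k].
- exact/asboolP/Omega_eq_refl.
- by apply/asboolP/asboolP => /Omega_eq_sym.
- by move=> /asboolP Oij /asboolP Ojk; apply/asboolP; apply: Omega_eq_trans Ojk.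
Qed.

Canonical var_eq_rel := EquivRelPack var_eq_equiv.

(** The terms of the language are its variables, so the term model is the
    quotient of the variables by provable equality. *)
Definition term_model := {eq_quot var_eq_rel}%qT.

Definition term (i : nat) : term_model := (\pi i)%qT.

Definition term_mem (a b : term_model) : Prop := Omega (FMem (repr a) (repr b)).

Lemma term_eqP i j : term i = term j <-> Omega (FEq i j).
Proof. by split=> [/eqmodP/asboolP//|Oij]; apply/eqmodP/asboolP. Qed.

Lemma term_repr a : term (repr a) = a.
Proof. exact: reprK. Qed.

Lemma repr_term i : Omega (FEq (repr (term i)) i).
Proof. by apply/term_eqP; rewrite term_repr. Qed.

Lemma term_memP i j : term_mem (term i) (term j) <-> Omega (FMem i j).
Proof.
by split; apply: Omega_mem_subst; (exact: repr_term) ||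
  (apply: Omega_eq_sym; exact: repr_term).
Qed.

(** Every assignment of the term model is a renaming followed by [term], which
    is why the induction is stated for all renamings. *)
Lemma truth p xi : sat term_mem (term \o xi) p <-> Omega (ren xi p).
Proof.
elim: p xi => [|i j|i j|p IHp q IHq|p IHp] xi /=.
- by split=> // /Omega_false.
- exact: term_eqP.
- exact: term_memP.
- by rewrite Omega_imp IHp IHq.
- have inst i : ren (scons i id) (ren (scons 0 (fun n => (xi n).+1)) p) =
      ren (scons i xi) p.
    by rewrite ren_comp; congr (ren _ p); apply/funext; case.
  have pushE i : push (term i) (term \o xi) = term \o scons i xi.
    by apply/funext; case.
  rewrite Omega_all; split=> [H i|H a].
    by rewrite inst -IHp -pushE.
  by rewrite -(term_repr a) pushE IHp -inst.
Qed.

Lemma term_model_axioms p rho : T p -> sat term_mem rho p.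
Proof.
move=> Tp; have -> : rho = term \o (repr \o rho).
  by apply/funext => n /=; rewrite term_repr.
by apply/truth/Omega_der0/der_axiom_ren.
Qed.

Lemma term_model_refutes : ~ sat term_mem term phi.
Proof.
have /truth : Omega (ren id (fnot phi)) by rewrite ren_id; exists 0; left.
exact.
Qed.

End Completeness.

Theorem completeness (T : fo_form -> Prop) (phi : fo_form) :
  (forall (M : Type) (E : M -> M -> Prop),
    (forall p rho, T p -> sat E rho p) -> forall rho, sat E rho phi) ->
  derives T [::] phi.
Proof.
move=> valid; apply: contrapT => unprovable.
apply: (@term_model_refutes T phi unprovable); apply: valid => p rho.
exact: term_model_axioms.
Qed.

(** * From a family of sets to a function *)

(** The index set and the field are kept general because the lemmas are used
    with rational indices over the real numbers, and with the field of a model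
    indexed by itself. The last three hypotheses say that [f x] is the supremum
    of [0] and of the [q j] with [x] outside [F j]. *)
Section Scale.
Local Open Scope classical_set_scope.
Local Open Scope ring_scope.
Variables (R : realFieldType) (X J : Type) (D : set J) (q : J -> R).
Variables (U F : J -> set X) (f : X -> R).

Hypothesis q01 : forall j, D j -> 0 < q j < 1.
Hypothesis dense : forall a b, 0 <= a -> a < b -> b <= 1 ->
  exists2 j, D j & a < q j < b.
Hypothesis sub_UF : forall j, D j -> U j `<=` F j.
Hypothesis sub_FU : forall i j, D i -> D j -> q i < q j -> F i `<=` U j.
Hypothesis f_ge0 : forall x, 0 <= f x.
Hypothesis f_ub : forall x j, D j -> ~ F j x -> q j <= f x.
Hypothesis f_least : forall x y, 0 <= y ->
  (forall j, D j -> ~ F j x -> q j <= y) -> f x <= y.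

Lemma scale_le1 x : f x <= 1.
Proof. by apply: f_least => // j /q01/andP[_ /ltW]. Qed.

Lemma scale_le_of_U j x : D j -> U j x -> f x <= q j.
Proof.
move=> Dj Ujx; apply: f_least => [|i Di nFix].
  by have /andP[/ltW] := q01 Dj.
rewrite leNgt; apply/negP => lt_ji.
exact/nFix/(sub_UF Di)/(sub_FU Dj Di lt_ji)/(sub_UF Dj).
Qed.

Lemma U_of_scale_lt j x : D j -> f x < q j -> U j x.
Proof.
move=> Dj lt_fj; have /andP[_ /ltW le1] := q01 Dj.
have [i Di /andP[lt_fi lt_ij]] := dense (f_ge0 x) lt_fj le1.
apply: (sub_FU Di Dj lt_ij); apply: contrapT => nFix.
by have := f_ub Di nFix; rewrite leNgt lt_fi.
Qed.

Lemma notF_of_scale_gt i x : D i -> q i < f x -> ~ F i x.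
Proof.
move=> Di lt_if Fix; have /andP[/ltW ge0 _] := q01 Di.
have [j Dj /andP[lt_ij lt_jf]] := dense ge0 lt_if (scale_le1 x).
have /(scale_le_of_U Dj) := sub_FU Di Dj lt_ij Fix.
by rewrite leNgt lt_jf.
Qed.

Lemma scale_eq0 x : (forall j, D j -> U j x) -> f x = 0.
Proof.
move=> allU; apply/eqP; rewrite eq_le f_ge0 andbT leNgt; apply/negP => fpos.
have [j Dj /andP[_ lt_jf]] := dense (lexx 0) fpos (scale_le1 x).
by have := scale_le_of_U Dj (allU j Dj); rewrite leNgt lt_jf.
Qed.

Lemma scale_eq1 x : (forall j, D j -> ~ F j x) -> f x = 1.
Proof.
move=> noF; apply/eqP; rewrite eq_le scale_le1 leNgt; apply/negP => flt1.
have [j Dj /andP[lt_fj _]] := dense (f_ge0 x) flt1 (lexx 1).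
by have := f_ub Dj (noF j Dj); rewrite leNgt lt_fj.
Qed.

(** The key step. Where [0 < f x < 1] both bounds are cut off by indices, one on
    each side of [f x], and the neighbourhood is a difference [U j `\` F i]. At
    the value [0] the lower bound holds everywhere and [U j] alone serves; at
    the value [1], likewise, the complement of [F i]. *)
Lemma scale_nbhs (mu : set (set X)) x a b :
  (forall j, D j -> mu (U j) /\ mu (~` F j)) ->
  (forall i j, D i -> D j -> q i < q j -> mu (U j `\` F i)) ->
  a < f x < b -> exists W, [/\ mu W, W x & forall y, W y -> a < f y < b].
Proof.
move=> mu1 mu2 /andP[lt_af lt_fb].
have upper : f x < 1 -> exists j, [/\ D j, U j x, f x < q j &
    forall y, U j y -> f y < b].
  move=> lt_f1; have [|||j Dj /andP[lt_fj]] := @dense (f x) (Num.min b 1).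
  - exact: f_ge0.
  - by rewrite lt_min lt_fb.
  - by rewrite ge_min lexx orbT.
  rewrite lt_min => /andP[lt_jb _]; exists j; split=> // [|y Ujy].
    exact: U_of_scale_lt.
  exact: le_lt_trans (scale_le_of_U Dj Ujy) lt_jb.
have lower : 0 < f x -> exists i, [/\ D i, ~ F i x, q i < f x &
    forall y, ~ F i y -> a < f y].
  move=> lt_0f; have [|||i Di /andP[]] := @dense (Num.max a 0) (f x).
  - by rewrite le_max lexx orbT.
  - by rewrite gt_max lt_af.
  - exact: scale_le1.
  rewrite gt_max => /andP[lt_ai _] lt_if; exists i; split=> // [|y nFiy].
    exact: notF_of_scale_gt.
  exact: lt_le_trans lt_ai (f_ub Di nFiy).
have [f0|fn0] := eqVneq (f x) 0.
  have [|j [Dj Ujx _ Ub]] := upper; first by rewrite f0 ltr01.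
  exists (U j); split=> // [|y Ujy]; first by have [] := mu1 j Dj.
  by rewrite Ub // andbT (lt_le_trans _ (f_ge0 y)) // -f0.
have [|i [Di nFix lt_if Fa]] := lower.
  by rewrite lt_neqAle eq_sym fn0 f_ge0.
have [f1|fn1] := eqVneq (f x) 1.
  exists (~` F i); split=> // [|y nFiy]; first by have [] := mu1 i Di.
  by rewrite Fa //= (le_lt_trans (scale_le1 y)) // -f1.
have [|j [Dj Ujx lt_fj Ub]] := upper; first by rewrite lt_neqAle fn1 scale_le1.
exists (U j `\` F i); split=> //.
  by apply: mu2 => //; apply: lt_trans lt_fj.
by move=> y [Ujy nFiy]; rewrite Fa //= Ub.
Qed.

End Scale.

(** * Density of a subfield with suprema *)

(** Completeness is assumed only for the sets needed, since a model of ZF has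
    suprema only for the subsets that it contains. The proofs avoid natural
    numbers, which in a model may be nonstandard: a subfield is not bounded,
    because subtracting [1] from its supremum would give a smaller bound. *)
Section DenseSubfield.
Local Open Scope classical_set_scope.
Local Open Scope ring_scope.
Variables (R : realFieldType) (Q : set R).
Hypotheses (Q1 : Q 1) (QD : forall x y, Q x -> Q y -> Q (x + y)).
Hypotheses (QN : forall x, Q x -> Q (- x)) (QV : forall x, Q x -> Q x^-1).

Definition has_lub_below (P : set R) : Prop :=
  P !=set0 -> (exists b, ubound P b) ->
  exists s, lbound (ubound P) s /\ ubound P s.

Hypothesis lubQ : has_lub_below Q.
Hypothesis lubQ_le : forall x, has_lub_below [set y | Q y /\ y <= x].

Lemma subfield_unbounded x : exists2 y, Q y & x < y.
Proof.
apply: contrapT => bounded.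
have ub_x : ubound Q x.
  by move=> y Qy; rewrite leNgt; apply/negP => lt_xy; apply: bounded; exists y.
have [||s [least_s ub_s]] := lubQ; [by exists 1|by exists x|].
suff /least_s : ubound Q (s - 1) by lra.
by move=> y Qy; have := ub_s _ (QD Qy Q1); lra.
Qed.

(** Let [N^-1] in the subfield be smaller than [b - a], and let [s] be the
    supremum of the elements up to [a]. An element above [s - N^-1] and at most
    [a] becomes, after adding [N^-1], larger than [s], hence larger than [a],
    and it stays below [b]. *)
Lemma subfield_dense a b : a < b -> exists2 y, Q y & a < y < b.
Proof.
move=> lt_ab; have ba0 : 0 < b - a by lra.
have [N QN_ ltN] := subfield_unbounded (b - a)^-1.
have N0 : 0 < N by apply: lt_trans ltN; rewrite invr_gt0.
have d0 : 0 < N^-1 by rewrite invr_gt0.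
have dlt : N^-1 < b - a by rewrite -[b - a]invrK ltf_pV2 ?posrE ?invr_gt0.
have [z Qz ltz] := subfield_unbounded (- a).
have [||s [least_s ub_s]] := @lubQ_le a.
- by exists (- z); split; [exact: QN|lra].
- by exists a => y [].
have [y [Qy le_ya] lt_sy] : exists2 y, Q y /\ y <= a & s - N^-1 < y.
  apply: contrapT => none.
  suff /least_s : ubound [set y | Q y /\ y <= a] (s - N^-1) by lra.
  by move=> y Py; rewrite leNgt; apply/negP => lt; apply: none; exists y.
have Qy' := QD Qy (QV QN_).
exists (y + N^-1) => //; apply/andP; split; last lra.
rewrite ltNge; apply/negP => le_a; have := ub_s _ (conj Qy' le_a); lra.
Qed.

End DenseSubfield.

(** * The equivalence over the real numbers *)

Section RealCase.
Local Open Scope classical_set_scope.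
Local Open Scope ring_scope.

Lemma real_equivalence (R : realType) (X : Type) (mu : set (set X)) :
    generalized_topology mu ->
    forall A B : set X, A !=set0 -> B !=set0 ->
    (exists f : X -> R,
      [/\ gcontinuous mu f,
          A `<=` f @^-1` [set 0] & B `<=` f @^-1` [set 1]])
    <->
    (exists U F : rat -> set X,
      [/\ forall r : rat, 0 < r < 1 ->
            [/\ mu (U r), gclosed mu (F r), A `<=` U r & U r `<=` F r],
          forall s r : rat, 0 < s < 1 -> 0 < r < 1 -> s < r ->
            F s `<=` U r /\ mu (U r `\` F s)
        & forall r : rat, 0 < r < 1 -> F r `&` B = set0]).
Proof.
move=> gt_mu A B _ _; split=> [[f [f_cont fA fB]]|[U [F [UF1 UF2 UF3]]]].
  exists (fun r => f @^-1` [set y | y < ratr r]).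
  exists (fun r => f @^-1` [set y | y <= ratr r]).
  split=> [r /andP[r0 _]|s r _ _ lt_sr|r /andP[_ r1]].
  - split=> [|||x /ltW//]; first exact/f_cont/open_lt.
      rewrite /gclosed.
      suff -> : ~` (f @^-1` [set y | y <= ratr r]) =
          f @^-1` [set y | ratr r < y].
        exact/f_cont/open_gt.
      by apply/seteqP; split=> x /=; rewrite real_ltNge ?num_real // => /negP.
    by move=> x /fA /= ->; rewrite ltr0q.
  - have lt_sr' : ratr s < ratr r :> R by rewrite ltr_rat.
    split=> [x /= /le_lt_trans|]; first exact.
    suff -> : f @^-1` [set y | y < ratr r] `\` f @^-1` [set y | y <= ratr s] =
        f @^-1` ([set y | y < ratr r] `&` [set y | ratr s < y]).
      by apply: f_cont; apply: openI; [exact: open_lt|exact: open_gt].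
    apply/seteqP; split=> x /= [ltr].
      by move=> /negP; rewrite -ltNge.
    by rewrite ltNge => /negP.
  - apply/seteqP; split=> // x [/= le_fr /fB /= f1].
    by move: le_fr; rewrite f1 leNgt -(rmorph1 (@ratr R)) ltr_rat r1.
pose D := [set r : rat | 0 < r < 1].
pose S x := [set 0 : R] `|` [set ratr r | r in [set r | D r /\ ~ F r x]].
pose f x := sup (S x).
have q01 (r : rat) : D r -> 0 < (ratr r : R) < 1.
  by rewrite /D /mkset -(ltr0q R) -(ltr_rat R r) rmorph1.
have S_ub x : ubound (S x) 1.
  by move=> _ [->|[r [Dr _] <-]] //; have /andP[_ /ltW] := q01 r Dr.
have S_sup x : has_sup (S x) by split; [exists 0; left|exists 1].
have f_ge0 x : 0 <= f x by apply: sup_upper_bound => //; left.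
have f_ub x r : D r -> ~ F r x -> ratr r <= f x.
  by move=> Dr nF; apply: sup_upper_bound => //; right; exists r.
have f_least x y :
    0 <= y -> (forall r, D r -> ~ F r x -> ratr r <= y) -> f x <= y.
  move=> y0 yub; apply: ge_sup; first by exists 0; left.
  by move=> _ [->|[r [Dr nF] <-]] //; apply: yub.
have dense (a b : R) : 0 <= a -> a < b -> b <= 1 ->
    exists2 r, D r & a < ratr r < b.
  move=> a0 lt_ab b1; have [r] := rat_in_itvoo lt_ab.
  rewrite in_itv /= => /andP[lt_ar lt_rb]; exists r; last by rewrite lt_ar.
  rewrite /D /mkset -(ltr0q R) -(ltr_rat R r) rmorph1 (le_lt_trans a0) //=.
  exact: lt_le_trans lt_rb b1.
have sub_UF r : D r -> U r `<=` F r by move=> /UF1[].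
have sub_FU s r : D s -> D r -> ratr s < ratr r :> R -> F s `<=` U r.
  by move=> Ds Dr; rewrite ltr_rat => /(UF2 s r Ds Dr)[].
exists f; split.
- move=> V openV.
  suff -> : f @^-1` V = \bigcup_(W in [set W | mu W /\ W `<=` f @^-1` V]) W.
    by apply: gt_mu => W [].
  apply/seteqP; split=> [x Vfx|x [W [_ sub_W] Wx]]; last exact: sub_W.
  have /nbhs_ballP[e /= e0 sub_V] : nbhs (f x) V by apply: open_nbhs_nbhs.
  have [|||W [muW Wx Wsub]] := scale_nbhs (a := f x - e) (b := f x + e)
    (mu := mu) q01 dense sub_UF sub_FU f_ge0 f_ub f_least (x := x).
  + by move=> r /UF1[].
  + by move=> s r Ds Dr; rewrite ltr_rat => /(UF2 s r Ds Dr)[].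
  + by apply/andP; split; lra.
  exists W => //; split=> // y /Wsub /andP[lt1 lt2]; apply: sub_V.
  by rewrite /ball /= ltr_norml; apply/andP; split; lra.
- move=> x Ax; apply: (scale_eq0 q01 dense sub_UF sub_FU f_ge0 f_least).
  by move=> r /UF1[_ _ sub_AU _]; apply: sub_AU.
- move=> x Bx; apply: (scale_eq1 q01 dense f_ge0 f_ub f_least).
  move=> r Dr Frx; have := UF3 r Dr.
  by move=> /seteqP[+ _] => /(_ x); apply.
Qed.

End RealCase.

(** * Ordered fields given by operations and axioms *)

Section OrderedField.
Local Open Scope ring_scope.
Variables (T : Type) (zero one : T) (opp inv : T -> T) (add mul : T -> T -> T).
Variable lt : T -> T -> Prop.
Hypotheses (addA : associative add) (addC : commutative add).
Hypotheses (add0 : left_id zero add) (addN : left_inverse zero opp add).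
Hypotheses (mulA : associative mul) (mulC : commutative mul).
Hypotheses (mul1 : left_id one mul) (mulDl : left_distributive mul add).
Hypotheses (one_neq0 : one <> zero).
Hypotheses (mulV : forall x, x <> zero -> mul (inv x) x = one).
Hypotheses (inv0 : inv zero = zero).
Hypotheses (lt_irr : forall x, ~ lt x x).
Hypotheses (lt_trans : forall x y z, lt x y -> lt y z -> lt x z).
Hypotheses (lt_total : forall x y, lt x y \/ x = y \/ lt y x).
Hypotheses (lt_add : forall x y z, lt x y -> lt (add x z) (add y z)).
Hypotheses (lt_mul : forall x y, lt zero x -> lt zero y -> lt zero (mul x y)).

(** Packing the operations as a [realFieldType] makes the theory of ordered
    fields available for them. The carrier of [K] is [T] itself; [v] and [w]
    keep this from being visible, so that nothing later depends on it. *)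
Lemma ordered_field_realField :
  exists (K : realFieldType) (v : T -> K) (w : K -> T),
  [/\ cancel v w & cancel w v] /\
  [/\ v zero = 0, v one = 1, {morph v : x y / add x y >-> x + y},
      {morph v : x y / mul x y >-> x * y} & forall x y, v x < v y <-> lt x y].
Proof.
pose Tc : choiceType := HB.pack T (gen_eqMixin T) (gen_choiceMixin T).
pose Tz : zmodType := HB.pack T Tc
  (@GRing.isZmodule.Build Tc zero opp add addA addC add0 addN).
have one0 : (one : Tz) != zero by apply/eqP.
pose Tr : comNzRingType := HB.pack T Tz
  (@GRing.Zmodule_isComNzRing.Build Tz one mul mulA mulC mul1 mulDl one0).
have mulVb (x : Tr) : x != 0 -> mul (inv x) x = one by move=> /eqP/mulV.
pose Tf : fieldType := HB.pack T Tr
  (@GRing.ComNzRing_isField.Build Tr inv mulVb inv0).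
pose ltb (x y : Tf) := `[< lt x y >].
pose leb (x y : Tf) := (x == y) || ltb x y.
pose norm (x : Tf) : Tf := if ltb x 0 then - x else x.
have ltb_add (x y : Tf) : ltb 0 x -> ltb 0 y -> ltb 0 (x + y).
  move=> /asboolP x0 /asboolP y0; apply/asboolP; apply: lt_trans y0 _.
  by have := lt_add y x0; rewrite add0.
have ltb_mul (x y : Tf) : ltb 0 x -> ltb 0 y -> ltb 0 (x * y).
  by move=> /asboolP x0 /asboolP y0; apply/asboolP; apply: lt_mul.
have ltb_asym (x : Tf) : ltb 0 x -> ~~ ltb x 0.
  by move=> /asboolP x0; apply/asboolP => /(lt_trans x0)/lt_irr.
have ltb_sub (x y : Tf) : ltb 0 (y - x) = ltb x y.
  apply/asboolP/asboolP => [/(lt_add x)|/(lt_add (- x : Tf))].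
    by rewrite -[add (y - x) x]/(y - x + x) subrK add0.
  by rewrite -[add x _]/(x - x) subrr.
have ltb_total (x : Tf) : x != 0 -> ltb 0 x || ltb x 0.
  move=> /eqP x0; have [?|[?|?]] := lt_total zero x.
  - by apply/orP; left; apply/asboolP.
  - by case: x0.
  - by apply/orP; right; apply/asboolP.
have normN (x : Tf) : norm (- x) = norm x.
  rewrite /norm -ltb_sub sub0r opprK; have [->|x0] := eqVneq x 0.
    by rewrite oppr0 !if_same.
  have := ltb_total x x0; have := @ltb_asym x.
  by case: (ltb 0 x) (ltb x 0) => -[] // /(_ isT).
have norm_ge0 (x : Tf) : leb 0 x -> norm x = x.
  move=> /orP[/eqP<-|x0]; rewrite /norm; first by rewrite oppr0 if_same.
  by rewrite (negbTE (ltb_asym _ x0)).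
pose K : realFieldType := HB.pack T Tf
  (@Num.IntegralDomain_isLtReal.Build Tf ltb leb norm ltb_add ltb_mul ltb_asym
    ltb_sub ltb_total normN norm_ge0 (fun _ _ => erefl)).
exists K, id, id; split; split=> // x y.
by split=> [/asboolP|?]; last exact/asboolP.
Qed.

End OrderedField.

(** * Meaning of formulas in a structure *)

Create HintDb means.

Section Meaning.
Variables (M : Type) (E : M -> M -> Prop).

(** The values of the bound variables form a stack [l], innermost binder first;
    [c] interprets the variables free in the whole formula. *)
Definition env (c : nat -> M) (l : seq M) : nat -> M := foldr (@push M) c l.

(** Variables are looked up by level, which counts from the bottom of the stack
    as in [expr], so that an entry stays valid when the stack grows. *)
Inductive var : seq M -> nat -> M -> Prop :=
| var_here l a : var (a :: l) (size l) a
| var_there l x a b : var l x a -> var (b :: l) x a.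

Lemma var_top l a n : size l = n -> var (a :: l) n a.
Proof. by move=> <-; exact: var_here. Qed.

Definition means (c : nat -> M) (l : seq M) (p : expr) (P : Prop) : Prop :=
  sat E (env c l) (p (size l)) <-> P.

Lemma var_env c l x a : var l x a -> x < size l /\ env c l (size l - x.+1) = a.
Proof.
elim=> {l x a} [l a|l x a b _ [lt_x <-]] /=; first by rewrite subnn.
by split; [exact: leqW|rewrite subSn].
Qed.

Lemma env_over c l n : env c l (size l + n) = c n.
Proof. by elim: l. Qed.

Lemma means_eq c l x y a b : var l x a -> var l y b ->
  means c l (xeq x y) (a = b).
Proof. by move=> /(var_env c)[_ <-] /(var_env c)[_ <-]. Qed.

Lemma means_mem c l x y a b : var l x a -> var l y b ->
  means c l (xmem x y) (E a b).
Proof. by move=> /(var_env c)[_ <-] /(var_env c)[_ <-]. Qed.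

Lemma means_false c l : means c l xfalse False.
Proof. by []. Qed.

Lemma means_imp c l p q P Q : means c l p P -> means c l q Q ->
  means c l (ximp p q) (P -> Q).
Proof. by rewrite /means /=; tauto. Qed.

Lemma means_not c l p P : means c l p P -> means c l (xnot p) (~ P).
Proof. by rewrite /means /=; tauto. Qed.

Lemma means_and c l p q P Q : means c l p P -> means c l q Q ->
  means c l (xand p q) (P /\ Q).
Proof.
rewrite /means /= => mp mq; split; last tauto.
by move=> npq; apply: contrapT; tauto.
Qed.

Lemma means_or c l p q P Q : means c l p P -> means c l q Q ->
  means c l (xor p q) (P \/ Q).
Proof.
rewrite /means /= => mp mq; split; last tauto.
by move=> npq; apply: contrapT; tauto.
Qed.

Lemma means_iff c l p q P Q : means c l p P -> means c l q Q ->
  means c l (xiff p q) (P <-> Q).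
Proof. by move=> mp mq; apply: means_and; apply: means_imp. Qed.

Lemma means_all c l (p : nat -> expr) (P : M -> Prop) :
  (forall a, means c (a :: l) (p (size l)) (P a)) ->
  means c l (xall p) (forall a, P a).
Proof. by move=> mp; split=> H a; apply/mp/H. Qed.

Lemma means_ex c l (p : nat -> expr) (P : M -> Prop) :
  (forall a, means c (a :: l) (p (size l)) (P a)) ->
  means c l (xex p) (exists a, P a).
Proof.
move=> mp; rewrite -[ex P]notK -forallNE.
by apply: means_not; apply: means_all => a; apply: means_not.
Qed.

(** Variants of [means_all] and [means_ex] for a formula still to be found: the
    level of the bound variable is then a numeral, and a body depending on it
    would be an ambiguous higher-order unification problem. *)
Lemma means_all_const c l (p : expr) (P : M -> Prop) :
  (forall a, means c (a :: l) p (P a)) ->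
  means c l (xall (fun=> p)) (forall a, P a).
Proof. exact: means_all. Qed.

Lemma means_ex_const c l (p : expr) (P : M -> Prop) :
  (forall a, means c (a :: l) p (P a)) ->
  means c l (xex (fun=> p)) (exists a, P a).
Proof. exact: means_ex. Qed.

Lemma means_xapp1 c l phi x a : var l x a ->
  means c l (xapp phi [:: x]) (sat E (push a c) phi).
Proof.
move=> /(var_env c)[_ xa]; rewrite /means /xapp sat_ren /=.
suff -> : push a c = env c l \o
  (fun n => if (n < 1)%N then (size l - (nth 0 [:: x] n).+1)%N
            else (size l + (n - 1))%N) by [].
by apply/funext => -[|n] /=; rewrite ?xa // subn1 env_over.
Qed.

Lemma means_xapp2 c l phi x y a b : var l x a -> var l y b ->
  means c l (xapp phi [:: x; y]) (sat E (push a (push b c)) phi).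
Proof.
move=> /(var_env c)[_ xa] /(var_env c)[_ yb]; rewrite /means /xapp sat_ren /=.
suff -> : push a (push b c) = env c l \o
  (fun n => if (n < 2)%N then (size l - (nth 0 [:: x; y] n).+1)%N
            else (size l + (n - 2))%N) by [].
by apply/funext => -[|[|n]] /=; rewrite ?xa ?yb // subn2 env_over.
Qed.

End Meaning.

(* The size of the stack is computed before it instantiates an unknown level:
   the unknown must not depend on the values that the stack holds. *)
#[global] Hint Resolve var_top var_there : means.
#[global] Hint Extern 0 (size _ = _) => (simpl; reflexivity) : means.
#[global] Hint Resolve means_eq means_mem means_false means_xapp1 means_xapp2
  : means.

(** The translation of a formula is directed by the proposition that it means.
    The formula may be an existential variable, which is then filled in. *)
Ltac means_step :=
  cbv beta;
  lazymatch goal with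
  | |- means _ _ _ _ (_ /\ _) => eapply means_and
  | |- means _ _ _ _ (_ \/ _) => eapply means_or
  | |- means _ _ _ _ (_ <-> _) => eapply means_iff
  | |- means _ _ _ _ (~ _) => eapply means_not
  | |- means _ _ _ ?p (exists _, _) =>
      tryif is_evar p then (eapply means_ex_const; intro)
      else (eapply means_ex; intro)
  | |- means _ _ _ _ (?A -> ?B) => eapply means_imp
  | |- means _ _ _ ?p (forall _, _) =>
      tryif is_evar p then (eapply means_all_const; intro)
      else (eapply means_all; intro)
  | |- means _ _ _ _ _ => solve [eauto 500 with means nocore]
  end.

Ltac solve_means := intros; repeat means_step.

(** * Formulas of the statement, read in a structure *)

Section Model.
Variables (M : Type) (E : M -> M -> Prop).
Local Notation "x ∈ y" := (E x y) (at level 70).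

(* Each predicate is the reading in [M] of the formula of the corresponding
   name, such as [Sub] of [subs] and [Upair] of [is_upair]. *)
Definition Sub a b := forall x, x ∈ a -> x ∈ b.
Definition Inhabited a := exists x, x ∈ a.
Definition Disjoint a b := ~ exists x, x ∈ a /\ x ∈ b.
Definition Setdiff c a b := forall x, x ∈ c <-> x ∈ a /\ ~ x ∈ b.
Definition Union u S := forall x, x ∈ u <-> exists a, a ∈ S /\ x ∈ a.
Definition Upair c a b := forall x, x ∈ c <-> x = a \/ x = b.
Definition Pair p a b :=
  exists s t, Upair s a a /\ Upair t a b /\ Upair p s t.
Definition Maps f a b := exists p, Pair p a b /\ p ∈ f.
Definition FunctionOn f D :=
  (forall p, p ∈ f -> exists x, x ∈ D /\ exists y, Pair p x y) /\
  (forall x, x ∈ D -> exists y, Maps f x y /\ forall z, Maps f x z -> z = y).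
Definition Function f D C :=
  FunctionOn f D /\ forall x, x ∈ D -> forall y, Maps f x y -> y ∈ C.
Definition Preimage P f V :=
  forall x, x ∈ P <-> exists y, y ∈ V /\ Maps f x y.
Definition SubsFiber A f c :=
  exists V P, Upair V c c /\ Preimage P f V /\ Sub A P.
Definition Opr op x y z := exists p, Pair p x y /\ Maps op p z.

Definition Binop op R :=
  (forall q, q ∈ op -> exists x, x ∈ R /\ exists y, y ∈ R /\
     exists z, z ∈ R /\ exists p, Pair p x y /\ Pair q p z) /\
  (forall x, x ∈ R -> forall y, y ∈ R ->
     exists z, Opr op x y z /\ forall t, Opr op x y t -> t = z).

Definition CommAssoc op R :=
  (forall x, x ∈ R -> forall y, y ∈ R -> forall z, z ∈ R ->
     Opr op x y z -> Opr op y x z) /\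
  (forall x, x ∈ R -> forall y, y ∈ R -> forall z, z ∈ R ->
   forall u, u ∈ R -> forall v, v ∈ R -> forall w, w ∈ R ->
     Opr op x y u -> Opr op u z w -> Opr op y z v -> Opr op x v w).

Definition FieldAxioms R pl ml o e :=
  Binop pl R /\ Binop ml R /\ CommAssoc pl R /\ CommAssoc ml R /\
  o ∈ R /\ e ∈ R /\ ~ (o = e) /\
  (forall x, x ∈ R -> Opr pl x o x) /\
  (forall x, x ∈ R -> Opr ml x e x) /\
  (forall x, x ∈ R -> exists y, y ∈ R /\ Opr pl x y o) /\
  (forall x, x ∈ R -> ~ (x = o) -> exists y, y ∈ R /\ Opr ml x y e) /\
  (forall x, x ∈ R -> forall y, y ∈ R -> forall z, z ∈ R ->
   forall s, s ∈ R -> forall t, t ∈ R -> forall u, u ∈ R -> forall v, v ∈ R ->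
     Opr pl y z s -> Opr ml x s t -> Opr ml x y u -> Opr ml x z v ->
     Opr pl u v t).

Definition FieldOrder R pl ml o lt :=
  (forall p, p ∈ lt -> exists x, x ∈ R /\ exists y, y ∈ R /\ Pair p x y) /\
  (forall x, x ∈ R -> ~ Maps lt x x) /\
  (forall x, x ∈ R -> forall y, y ∈ R -> forall z, z ∈ R ->
     Maps lt x y -> Maps lt y z -> Maps lt x z) /\
  (forall x, x ∈ R -> forall y, y ∈ R ->
     Maps lt x y \/ x = y \/ Maps lt y x) /\
  (forall x, x ∈ R -> forall y, y ∈ R -> forall z, z ∈ R ->
   forall u, u ∈ R -> forall v, v ∈ R ->
     Maps lt x y -> Opr pl x z u -> Opr pl y z v -> Maps lt u v) /\
  (forall x, x ∈ R -> forall y, y ∈ R -> forall z, z ∈ R ->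
     Maps lt o x -> Maps lt o y -> Opr ml x y z -> Maps lt o z).

Definition Le lt x y := Maps lt x y \/ x = y.
Definition UpperBound lt S x := forall y, y ∈ S -> Le lt y x.
Definition Complete R lt :=
  forall S, Sub S R -> Inhabited S ->
  (exists x, x ∈ R /\ UpperBound lt S x) ->
  exists x, x ∈ R /\ UpperBound lt S x /\
    (forall y, y ∈ R -> UpperBound lt S y -> Le lt x y).
Definition Reals R pl ml o e lt :=
  FieldAxioms R pl ml o e /\ FieldOrder R pl ml o lt /\ Complete R lt.

Definition Subfield K R pl ml o e :=
  Sub K R /\ o ∈ K /\ e ∈ K /\
  (forall x, x ∈ K -> forall y, y ∈ K -> forall z, Opr pl x y z -> z ∈ K) /\
  (forall x, x ∈ K -> forall y, y ∈ K -> forall z, Opr ml x y z -> z ∈ K) /\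
  (forall x, x ∈ K -> forall y, y ∈ R -> Opr pl x y o -> y ∈ K) /\
  (forall x, x ∈ K -> forall y, y ∈ R -> Opr ml x y e -> y ∈ K).
Definition Rationals Q R pl ml o e :=
  Subfield Q R pl ml o e /\
  forall K, Subfield K R pl ml o e -> Sub Q K.
Definition UnitInterval I Q lt o e :=
  forall r, r ∈ I <-> r ∈ Q /\ Maps lt o r /\ Maps lt r e.
Definition UsualTopology tau R lt :=
  forall V, V ∈ tau <-> Sub V R /\
    forall x, x ∈ V -> exists a, a ∈ R /\ exists b, b ∈ R /\
      Maps lt a x /\ Maps lt x b /\
      forall y, y ∈ R -> Maps lt a y -> Maps lt y b -> y ∈ V.
Definition GTopology mu X :=
  (forall U, U ∈ mu -> Sub U X) /\
  forall S, Sub S mu -> exists U, U ∈ mu /\ Union U S.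
Definition GClosed F mu X := Sub F X /\ exists C, C ∈ mu /\ Setdiff C X F.
Definition Continuous f mu tau :=
  forall V, V ∈ tau -> exists P, P ∈ mu /\ Preimage P f V.
Definition MapsPair G r U F := exists v, Pair v U F /\ Maps G r v.

(** Each lemma below matches a definition of the formal language with its
    counterpart on [M], so that larger formulas are translated constant by
    constant instead of being unfolded down to membership. *)

Lemma means_subs env0 l a b a' b' :
  var l a a' -> var l b b' ->
  means E env0 l (subs a b) (Sub a' b').
Proof. by move=> *; rewrite /Sub; solve_means. Qed.
#[local] Hint Resolve means_subs : means.

Lemma means_inhabited env0 l a a' :
  var l a a' ->
  means E env0 l (is_inhabited a) (Inhabited a').
Proof. by move=> *; rewrite /Inhabited; solve_means. Qed.
#[local] Hint Resolve means_inhabited : means.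

Lemma means_disjoint env0 l a b a' b' :
  var l a a' -> var l b b' ->
  means E env0 l (are_disjoint a b) (Disjoint a' b').
Proof. by move=> *; rewrite /Disjoint; solve_means. Qed.
#[local] Hint Resolve means_disjoint : means.

Lemma means_setdiff env0 l c a b c' a' b' :
  var l c c' -> var l a a' -> var l b b' ->
  means E env0 l (is_setdiff c a b) (Setdiff c' a' b').
Proof. by move=> *; rewrite /Setdiff; solve_means. Qed.
#[local] Hint Resolve means_setdiff : means.

Lemma means_union env0 l u S u' S' :
  var l u u' -> var l S S' ->
  means E env0 l (is_union u S) (Union u' S').
Proof. by move=> *; rewrite /Union; solve_means. Qed.
#[local] Hint Resolve means_union : means.

Lemma means_upair env0 l c a b c' a' b' :
  var l c c' -> var l a a' -> var l b b' ->
  means E env0 l (is_upair c a b) (Upair c' a' b').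
Proof. by move=> *; rewrite /Upair; solve_means. Qed.
#[local] Hint Resolve means_upair : means.

Lemma means_pair env0 l p a b p' a' b' :
  var l p p' -> var l a a' -> var l b b' ->
  means E env0 l (is_pair p a b) (Pair p' a' b').
Proof. by move=> *; rewrite /Pair; solve_means. Qed.
#[local] Hint Resolve means_pair : means.

Lemma means_maps env0 l f a b f' a' b' :
  var l f f' -> var l a a' -> var l b b' ->
  means E env0 l (maps f a b) (Maps f' a' b').
Proof. by move=> *; rewrite /Maps; solve_means. Qed.
#[local] Hint Resolve means_maps : means.

Lemma means_function_on env0 l f D f' D' :
  var l f f' -> var l D D' ->
  means E env0 l (is_function_on f D) (FunctionOn f' D').
Proof. by move=> *; rewrite /FunctionOn; solve_means. Qed.
#[local] Hint Resolve means_function_on : means.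

Lemma means_function env0 l f D C f' D' C' :
  var l f f' -> var l D D' -> var l C C' ->
  means E env0 l (is_function f D C) (Function f' D' C').
Proof. by move=> *; rewrite /Function; solve_means. Qed.
#[local] Hint Resolve means_function : means.

Lemma means_preimage env0 l P f V P' f' V' :
  var l P P' -> var l f f' -> var l V V' ->
  means E env0 l (is_preimage P f V) (Preimage P' f' V').
Proof. by move=> *; rewrite /Preimage; solve_means. Qed.
#[local] Hint Resolve means_preimage : means.

Lemma means_subs_fiber env0 l A f c A' f' c' :
  var l A A' -> var l f f' -> var l c c' ->
  means E env0 l (subs_fiber A f c) (SubsFiber A' f' c').
Proof. by move=> *; rewrite /SubsFiber; solve_means. Qed.
#[local] Hint Resolve means_subs_fiber : means.

Lemma means_opr env0 l op x y z op' x' y' z' :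
  var l op op' -> var l x x' -> var l y y' -> var l z z' ->
  means E env0 l (opr op x y z) (Opr op' x' y' z').
Proof. by move=> *; rewrite /Opr; solve_means. Qed.
#[local] Hint Resolve means_opr : means.

Lemma means_binop env0 l op R op' R' :
  var l op op' -> var l R R' ->
  means E env0 l (is_binop op R) (Binop op' R').
Proof. by move=> *; rewrite /Binop; solve_means. Qed.
#[local] Hint Resolve means_binop : means.

Lemma means_comm_assoc env0 l op R op' R' :
  var l op op' -> var l R R' ->
  means E env0 l (is_comm_assoc op R) (CommAssoc op' R').
Proof. by move=> *; rewrite /CommAssoc; solve_means. Qed.
#[local] Hint Resolve means_comm_assoc : means.

Lemma means_field env0 l R pl ml o e R' pl' ml' o' e' :
  var l R R' -> var l pl pl' -> var l ml ml' -> var l o o' -> var l e e' ->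
  means E env0 l (is_field R pl ml o e) (FieldAxioms R' pl' ml' o' e').
Proof. by move=> *; rewrite /FieldAxioms; solve_means. Qed.
#[local] Hint Resolve means_field : means.

Lemma means_field_order env0 l R pl ml o lt R' pl' ml' o' lt' :
  var l R R' -> var l pl pl' -> var l ml ml' -> var l o o' -> var l lt lt' ->
  means E env0 l (is_field_order R pl ml o lt) (FieldOrder R' pl' ml' o' lt').
Proof. by move=> *; rewrite /FieldOrder; solve_means. Qed.
#[local] Hint Resolve means_field_order : means.

Lemma means_le env0 l lt x y lt' x' y' :
  var l lt lt' -> var l x x' -> var l y y' ->
  means E env0 l (is_le lt x y) (Le lt' x' y').
Proof. by move=> *; rewrite /Le; solve_means. Qed.
#[local] Hint Resolve means_le : means.

Lemma means_upper_bound env0 l lt S x lt' S' x' :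
  var l lt lt' -> var l S S' -> var l x x' ->
  means E env0 l (is_upper_bound lt S x) (UpperBound lt' S' x').
Proof. by move=> *; rewrite /UpperBound; solve_means. Qed.
#[local] Hint Resolve means_upper_bound : means.

Lemma means_complete env0 l R lt R' lt' :
  var l R R' -> var l lt lt' ->
  means E env0 l (is_complete R lt) (Complete R' lt').
Proof. by move=> *; rewrite /Complete; solve_means. Qed.
#[local] Hint Resolve means_complete : means.

Lemma means_reals env0 l R pl ml o e lt R' pl' ml' o' e' lt' :
  var l R R' -> var l pl pl' -> var l ml ml' -> var l o o' -> var l e e' ->
  var l lt lt' ->
  means E env0 l (is_reals R pl ml o e lt) (Reals R' pl' ml' o' e' lt').
Proof. by move=> *; rewrite /Reals; solve_means. Qed.
#[local] Hint Resolve means_reals : means.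

Lemma means_subfield env0 l K R pl ml o e K' R' pl' ml' o' e' :
  var l K K' -> var l R R' -> var l pl pl' -> var l ml ml' -> var l o o' ->
  var l e e' ->
  means E env0 l (is_subfield K R pl ml o e) (Subfield K' R' pl' ml' o' e').
Proof. by move=> *; rewrite /Subfield; solve_means. Qed.
#[local] Hint Resolve means_subfield : means.

Lemma means_rationals env0 l Q R pl ml o e Q' R' pl' ml' o' e' :
  var l Q Q' -> var l R R' -> var l pl pl' -> var l ml ml' -> var l o o' ->
  var l e e' ->
  means E env0 l (is_rationals Q R pl ml o e) (Rationals Q' R' pl' ml' o' e').
Proof. by move=> *; rewrite /Rationals; solve_means. Qed.
#[local] Hint Resolve means_rationals : means.

Lemma means_unit_interval env0 l I Q lt o e I' Q' lt' o' e' :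
  var l I I' -> var l Q Q' -> var l lt lt' -> var l o o' -> var l e e' ->
  means E env0 l (is_rational_unit_interval I Q lt o e)
    (UnitInterval I' Q' lt' o' e').
Proof. by move=> *; rewrite /UnitInterval; solve_means. Qed.
#[local] Hint Resolve means_unit_interval : means.

Lemma means_usual_topology env0 l tau R lt tau' R' lt' :
  var l tau tau' -> var l R R' -> var l lt lt' ->
  means E env0 l (is_usual_topology tau R lt) (UsualTopology tau' R' lt').
Proof. by move=> *; rewrite /UsualTopology; solve_means. Qed.
#[local] Hint Resolve means_usual_topology : means.

Lemma means_gtopology env0 l mu X mu' X' :
  var l mu mu' -> var l X X' ->
  means E env0 l (is_gtopology mu X) (GTopology mu' X').
Proof. by move=> *; rewrite /GTopology; solve_means. Qed.
#[local] Hint Resolve means_gtopology : means.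

Lemma means_gclosed env0 l F mu X F' mu' X' :
  var l F F' -> var l mu mu' -> var l X X' ->
  means E env0 l (is_gclosed F mu X) (GClosed F' mu' X').
Proof. by move=> *; rewrite /GClosed; solve_means. Qed.
#[local] Hint Resolve means_gclosed : means.

Lemma means_continuous env0 l f mu tau f' mu' tau' :
  var l f f' -> var l mu mu' -> var l tau tau' ->
  means E env0 l (is_continuous f mu tau) (Continuous f' mu' tau').
Proof. by move=> *; rewrite /Continuous; solve_means. Qed.
#[local] Hint Resolve means_continuous : means.

Lemma means_maps_pair env0 l G r U F G' r' U' F' :
  var l G G' -> var l r r' -> var l U U' -> var l F F' ->
  means E env0 l (maps_pair G r U F) (MapsPair G' r' U' F').
Proof. by move=> *; rewrite /MapsPair; solve_means. Qed.
#[local] Hint Resolve means_maps_pair : means.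

(** * Elementary set theory in a model of ZF *)

Hypothesis model_ZF : forall p rho, ZF p -> sat E rho p.


Lemma sat_close c (p : expr) (P : Prop) :
  means E c [::] p P -> P -> sat E c (Defs.close p).
Proof. by move=> mp /mp. Qed.

Lemma axiom_meaning c (p : expr) P :
  ZF (Defs.close p) -> means E c [::] p P -> P.
Proof. by move=> /(model_ZF c) Zp mp; apply/mp. Qed.

Lemma ext a b : (forall x, x ∈ a <-> x ∈ b) -> a = b.
Proof.
apply: (axiom_meaning (c := fun=> a)
  (P := forall a b, (forall x, x ∈ a <-> x ∈ b) -> a = b) ZF_extensionality).
by solve_means.
Qed.

Lemma upair_ex a b : exists c, Upair c a b.
Proof.
apply: (axiom_meaning (c := fun=> a)
  (P := forall a b, exists c, forall x, x ∈ c <-> x = a \/ x = b) ZF_pairing).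
by solve_means.
Qed.

(** Separation for a predicate [P] on the model with parameters [l]. The schema
    is instantiated with the formula that means [P], and the parameters become
    the values of its remaining free variables. *)
Lemma separation l p (P : M -> Prop) a :
  (forall c x, means E c (x :: l) p (P x)) ->
  exists b, forall x, x ∈ b <-> x ∈ a /\ P x.
Proof.
move=> mp; set phi := p (size l).+1; pose c0 : nat -> M := fun=> a.
pose Q x := sat E (push x (env c0 l)) phi.
have QP x : Q x <-> P x by exact: mp.
suff /(_ a)[b bP] : forall a, exists b, forall x, x ∈ b <-> x ∈ a /\ Q x.
  by exists b => x; rewrite (bP x) (QP x).
rewrite /Q; apply: (axiom_meaning (c := env c0 l) (ZF_separation phi)).
by solve_means.
Qed.

Lemma replacement l p (P : M -> M -> Prop) a :
  (forall c x y, means E c (x :: y :: l) p (P x y)) ->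
  (forall x, x ∈ a -> forall y z, P x y -> P x z -> y = z) ->
  exists b, forall y, y ∈ b <-> exists x, x ∈ a /\ P x y.
Proof.
move=> mp P_fun; set phi := p (size l).+2; pose c0 : nat -> M := fun=> a.
pose Q x y := sat E (push x (push y (env c0 l))) phi.
have QP x y : Q x y <-> P x y by exact: mp.
suff /(_ a)[|b bP] : forall a,
    (forall x, x ∈ a -> forall y z, Q x y -> Q x z -> y = z) ->
    exists b, forall y, y ∈ b <-> exists x, x ∈ a /\ Q x y.
- by move=> x ax y z /QP Py /QP Pz; apply: P_fun Py Pz.
- by exists b => y; rewrite bP; split=> -[x [ax /QP Pxy]]; exists x.
rewrite /Q; apply: (axiom_meaning (c := env c0 l) (ZF_replacement phi)).
by solve_means.
Qed.

Lemma upair_eq c a b c' : Upair c a b -> Upair c' a b -> c = c'.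
Proof. by move=> cP c'P; apply: ext => x; rewrite (cP x) (c'P x). Qed.

Lemma upair_inj c a b a' b' : Upair c a b -> Upair c a' b' ->
  (a = a' /\ b = b') \/ (a = b' /\ b = a').
Proof.
move=> P P'.
have /P' := (P a).2 (or_introl erefl); have /P' := (P b).2 (or_intror erefl).
have /P := (P' a').2 (or_introl erefl); have /P := (P' b').2 (or_intror erefl).
by do 4![case=> ?]; subst; tauto.
Qed.

Lemma pair_ex a b : exists p, Pair p a b.
Proof.
have [s sP] := upair_ex a a; have [t tP] := upair_ex a b.
by have [p pP] := upair_ex s t; exists p, s, t.
Qed.

Lemma pair_eq p q a b : Pair p a b -> Pair q a b -> p = q.
Proof.
move=> [s [t [sP [tP pP]]]] [s' [t' [s'P [t'P qP]]]].
by apply: upair_eq pP _; rewrite (upair_eq sP s'P) (upair_eq tP t'P).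
Qed.

Lemma pair_inj p a b a' b' : Pair p a b -> Pair p a' b' -> a = a' /\ b = b'.
Proof.
move=> [s [t [sP [tP pP]]]] [s' [t' [s'P [t'P qP]]]].
case: (upair_inj pP qP) => -[? ?]; subst.
  have := upair_inj sP s'P; have := upair_inj tP t'P.
  by do 2![case=> -[? ?]]; subst.
have := upair_inj sP t'P; have := upair_inj tP s'P.
by do 2![case=> -[? ?]]; subst.
Qed.


Lemma maps_function_dom f D C x y : Function f D C -> Maps f x y -> x ∈ D.
Proof.
move=> [[fpair _] _] [p [pP /fpair[x' [x'D [y' p'P]]]]].
by have [-> _] := pair_inj pP p'P.
Qed.

(** Functions defined by a formula exist: replacement collects the pairs of the
    graph. In the stack, the pair [q] lies below its components [x] and [y]. *)
Lemma function_ex l p (P : M -> M -> Prop) D :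
  (forall c q x y, means E c (y :: x :: q :: l) p (P x y)) ->
  (forall x, x ∈ D -> exists y, P x y /\ forall z, P x z -> z = y) ->
  exists f, FunctionOn f D /\
    forall x, x ∈ D -> forall y, Maps f x y <-> P x y.
Proof.
move=> mp P_fun.
have [|x xD q q' [y [qP Pxy]] [y' [q'P Pxy']]|f fP] :=
    @replacement l
      (xex (fun=> xand (is_pair (size l) (size l).+1 (size l).+2) p))
      (fun x q => exists y, Pair q x y /\ P x y) D.
- move=> c x q; apply: means_ex_const => y; apply: means_and => //.
  by solve_means.
- have [z [_ zP]] := P_fun x xD.
  by move: qP q'P; rewrite (zP _ Pxy) (zP _ Pxy') => qP; apply: pair_eq qP.
have mapsP x y : x ∈ D -> Maps f x y <-> P x y.
  move=> xD; split=> [[q [qP /fP[x' [_ [y' [q'P Pxy]]]]]]|Pxy].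
    by have [-> ->] := pair_inj qP q'P.
  have [q qP] := pair_ex x y; exists q; split=> //.
  by apply/fP; exists x; split=> //; exists y.
exists f; split; last by move=> x xD y; apply: mapsP.
split=> [q /fP[x [xD [y [qP _]]]]|x xD].
  by exists x; split=> //; exists y.
have [y [Pxy yP]] := P_fun x xD; exists y.
by split=> [|z]; [apply/mapsP|move=> /mapsP zP; apply: yP; exact: zP].
Qed.

(** * The field of real numbers of a model *)

Section Reals.
Local Open Scope classical_set_scope.
Local Open Scope ring_scope.
Variables R pl ml o e lt : M.
Hypothesis realsR : Reals R pl ml o e lt.

Let T := {x | x ∈ R}.

Lemma sval_inj (x y : T) : sval x = sval y -> x = y.
Proof.
case: x y => [x xR] [y yR] /= xy; subst; congr exist.
exact: Prop_irrelevance.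
Qed.

Lemma opr_in op x y z : Binop op R -> Opr op x y z -> [/\ x ∈ R, y ∈ R & z ∈ R].
Proof.
move=> [op_in _] [p [pP [q [qP /op_in]]]].
move=> [x' [x'R [y' [y'R [z' [z'R [p' [p'P q'P]]]]]]]].
have [? ?] := pair_inj qP q'P; subst p' z'.
by have [? ?] := pair_inj pP p'P; subst x' y'.
Qed.

Lemma binop_operation op : Binop op R -> exists g : T -> T -> T,
  forall x y z, Opr op (sval x) (sval y) (sval z) <-> z = g x y.
Proof.
move=> bop; have [|g gP] := @choice (T * T) T
    (fun xy z => forall t, Opr op (sval xy.1) (sval xy.2) (sval t) <-> t = z).
  move=> [x y]; have [z [xyz zP]] := bop.2 _ (svalP x) _ (svalP y).
  have [_ _ zR] := opr_in bop xyz.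
  by exists (exist _ z zR) => t /=; split=> [/zP ?|->//]; apply: sval_inj.
by exists (fun x y => g (x, y)) => x y z; apply: gP (x, y) z.
Qed.

(** The elements of [R] are the values of an order isomorphism [v] from an
    ordered field [K]. This [K] is a complete ordered field in the sense of the
    model only. *)
Lemma reals_coordinates : exists (K : realFieldType) (v : K -> M),
  [/\ injective v, forall a, a ∈ R <-> exists x, v x = a, v 0 = o & v 1 = e] /\
  [/\ forall x y z, Opr pl (v x) (v y) (v z) <-> z = x + y,
      forall x y z, Opr ml (v x) (v y) (v z) <-> z = x * y &
      forall x y, Maps lt (v x) (v y) <-> x < y].
Proof.
have [[bpl [bml [[plC plA] [[mlC mlA] [oR [eR [oe]]]]]]]] := realsR.
move=> [pl0 [ml1 [plN [mlV mlD]]]].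
move=> [[_ [lt_irr [lt_trans [lt_tot [lt_add lt_mul]]]]] _].
have [add addP] := binop_operation bpl; have [mul mulP] := binop_operation bml.
pose zero : T := exist _ o oR; pose one : T := exist _ e eR.
have [|opp oppP] := @choice T T (fun x y => add x y = zero).
  move=> x; have [y [yR xy]] := plN _ (svalP x).
  by exists (exist _ y yR); apply/esym/addP.
have [|inv invP] := @choice T T (fun x y =>
    (x = zero -> y = zero) /\ (x <> zero -> mul x y = one)).
  move=> x; have [x0|x0] := pselect (x = zero); first by exists zero; split.
  have [|y [yR xy]] := mlV _ (svalP x); first by move=> x_o; apply/x0/sval_inj.
  by exists (exist _ y yR); split=> // _; apply/esym/mulP.
have addE x y : Opr pl (sval x) (sval y) (sval (add x y)) by exact/addP.
have mulE x y : Opr ml (sval x) (sval y) (sval (mul x y)) by exact/mulP.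
have addC : commutative add.
  move=> x y; apply/addP.
  exact: (plC _ (svalP x) _ (svalP y) _ (svalP (add x y)) (addE x y)).
have mulC : commutative mul.
  move=> x y; apply/mulP.
  exact: (mlC _ (svalP x) _ (svalP y) _ (svalP (mul x y)) (mulE x y)).
have addA : associative add.
  move=> x y z; apply/esym/addP.
  exact: (plA _ (svalP x) _ (svalP y) _ (svalP z) _ (svalP (add x y))
    _ (svalP (add y z)) _ (svalP (add (add x y) z))
    (addE x y) (addE (add x y) z) (addE y z)).
have mulA : associative mul.
  move=> x y z; apply/esym/mulP.
  exact: (mlA _ (svalP x) _ (svalP y) _ (svalP z) _ (svalP (mul x y))
    _ (svalP (mul y z)) _ (svalP (mul (mul x y) z))
    (mulE x y) (mulE (mul x y) z) (mulE y z)).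
have add0 : left_id zero add.
  by move=> x; rewrite addC; apply/esym/addP; exact: (pl0 _ (svalP x)).
have mul1 : left_id one mul.
  by move=> x; rewrite mulC; apply/esym/mulP; exact: (ml1 _ (svalP x)).
have addN : left_inverse zero opp add by move=> x; rewrite addC.
have mulDl : left_distributive mul add.
  move=> x y z; rewrite ![mul _ z]mulC; apply/addP.
  exact: (mlD _ (svalP z) _ (svalP x) _ (svalP y) _ (svalP (add x y))
    _ (svalP (mul z (add x y))) _ (svalP (mul z x)) _ (svalP (mul z y))
    (addE x y) (mulE z (add x y)) (mulE z x) (mulE z y)).
have one0 : one <> zero by move=> [/esym].
have mulV x : x <> zero -> mul (inv x) x = one.
  by move=> x0; rewrite mulC; apply: (invP x).2.
have inv0 : inv zero = zero by apply: (invP zero).1.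
have [|||||K [v [w [[vK wK] [v0 v1 vD vM v_lt]]]]] :=
  @ordered_field_realField T zero one opp inv add mul
    (fun x y => Maps lt (sval x) (sval y)) addA addC add0 addN mulA mulC mul1
    mulDl one0 mulV inv0.
- by move=> x; exact: (lt_irr _ (svalP x)).
- by move=> x y z; exact: (lt_trans _ (svalP x) _ (svalP y) _ (svalP z)).
- move=> x y; have := lt_tot _ (svalP x) _ (svalP y).
  by move=> [?|[/sval_inj ?|?]]; [left|right; left|right; right].
- move=> x y z xy.
  exact: (lt_add _ (svalP x) _ (svalP y) _ (svalP z) _ (svalP (add x z))
    _ (svalP (add y z)) xy (addE x z) (addE y z)).
- move=> x y x0 y0.
  exact: (lt_mul _ (svalP x) _ (svalP y) _ (svalP (mul x y)) x0 y0 (mulE x y)).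
exists K, (fun x => sval (w x)); split; split.
- by move=> x y /sval_inj /(can_inj wK).
- move=> a; split=> [aR|[x <-]]; last exact: (svalP (w x)).
  by exists (v (exist _ a aR)); rewrite vK.
- by rewrite -v0 vK.
- by rewrite -v1 vK.
- move=> x y z; rewrite (addP (w x) (w y) (w z)); split=> [/(congr1 v)|->].
    by rewrite vD !wK.
  by rewrite -[x in LHS]wK -[y in LHS]wK -vD vK.
- move=> x y z; rewrite (mulP (w x) (w y) (w z)); split=> [/(congr1 v)|->].
    by rewrite vM !wK.
  by rewrite -[x in LHS]wK -[y in LHS]wK -vM vK.
- by move=> x y; rewrite -v_lt !wK.
Qed.

End Reals.

(** * The equivalence in a model *)

Section Coordinates.
Local Open Scope classical_set_scope.
Local Open Scope ring_scope.
Variables (R pl ml o e lt Q I tau X mu : M).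
Variables (K : realFieldType) (v : K -> M).
Hypothesis v_inj : injective v.
Hypothesis R_v : forall a, a ∈ R <-> exists x, v x = a.
Hypothesis v0 : v 0 = o.
Hypothesis v1 : v 1 = e.
Hypothesis v_pl : forall x y z, Opr pl (v x) (v y) (v z) <-> z = x + y.
Hypothesis v_ml : forall x y z, Opr ml (v x) (v y) (v z) <-> z = x * y.
Hypothesis v_lt : forall x y, Maps lt (v x) (v y) <-> x < y.
Hypothesis completeR : Complete R lt.
Hypothesis subfieldQ : Subfield Q R pl ml o e.
Hypothesis intervalI : UnitInterval I Q lt o e.
Hypothesis topology : UsualTopology tau R lt.
Hypothesis gtop : GTopology mu X.

Lemma v_R x : v x ∈ R.
Proof. by apply/R_v; exists x. Qed.

Lemma v_le x y : Le lt (v x) (v y) <-> x <= y.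
Proof.
rewrite le_eqVlt; split=> [[/v_lt ->|/v_inj ->]|/predU1P[->|/v_lt]].
- by rewrite orbT.
- by rewrite eqxx.
- by right.
- by left.
Qed.

Lemma complete_coord S : Sub S R -> has_lub_below [set k | v k ∈ S].
Proof.
move=> sub_SR [k kS] [b b_ub].
have [||s [sR [s_ub s_least]]] := completeR sub_SR; first by exists (v k).
  exists (v b); split=> [|a aS]; first exact: v_R.
  by have /R_v[j ja] := sub_SR a aS; subst a; apply/v_le/b_ub.
have /R_v[j ja] := sR; subst s; exists j; split=> [i i_ub|i /s_ub /v_le//].
apply/v_le/s_least; first exact: v_R.
by move=> a aS; have /R_v[h ha] := sub_SR a aS; subst a; apply/v_le/i_ub.
Qed.

(** [subfield_dense] asks for the suprema of [Q] and of its initial segments;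
    both are sets of the model, the segments by separation. *)
Lemma rationals_dense a b : a < b -> exists2 q, v q ∈ Q & a < q < b.
Proof.
have [sub_QR [Qo [Qe [QD [QM [QN QV]]]]]] := subfieldQ.
apply: (@subfield_dense K [set k | v k ∈ Q]) => /=.
- by rewrite v1.
- by move=> x y Qx Qy; apply: (QD _ Qx _ Qy); apply/v_pl.
- move=> x Qx; apply: (QN _ Qx _ (v_R _)).
  by rewrite -v0; apply/v_pl; rewrite subrr.
- move=> x Qx; have [->|x0] := eqVneq x 0; first by rewrite invr0 v0.
  by apply: (QV _ Qx _ (v_R _)); rewrite -v1; apply/v_ml; rewrite divff.
- exact: complete_coord.
move=> x; have [S SP] : exists S, forall y, y ∈ S <-> y ∈ Q /\ Le lt y (v x).
  by eapply (separation (l := [:: v x; lt])); solve_means.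
have -> : [set y | v y ∈ Q /\ y <= x] = [set k | v k ∈ S].
  apply/seteqP; split=> y /=; rewrite (SP (v y)) => -[Qy le].
    by split=> //; apply/v_le.
  by split=> //; apply/v_le.
by apply: complete_coord => y /SP[/sub_QR].
Qed.

Lemma v_I x : v x ∈ I <-> v x ∈ Q /\ 0 < x < 1.
Proof.
rewrite (intervalI (v x)) -v0 -v1.
split=> [[Qx [/v_lt x0 /v_lt x1]]|[Qx /andP[x0 x1]]]; first by rewrite x0.
by split=> //; split; apply/v_lt.
Qed.

Lemma I_v a : a ∈ I -> exists x, v x = a.
Proof. by move=> /intervalI[/subfieldQ.1 /R_v]. Qed.

Lemma dense_I a b : 0 <= a -> a < b -> b <= 1 ->
  exists2 q, v q ∈ I & a < q < b.
Proof.
move=> a0 /rationals_dense[q Qq /andP[aq qb]] b1.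
by exists q; [apply/v_I; split=> //; lra|rewrite aq].
Qed.

Lemma open_coord V (P : K -> Prop) :
  (forall y, y ∈ V <-> exists2 k, v k = y & P k) ->
  (forall k, P k -> exists a b, a < k < b /\ forall j, a < j < b -> P j) ->
  V ∈ tau.
Proof.
move=> VP openP; apply/topology; split=> [y /VP[k <- _]|y]; first exact: v_R.
move=> /VP[k <- /openP[a [b [/andP[ak kb] abP]]]].
exists (v a); split; first exact: v_R.
exists (v b); split; first exact: v_R.
split; first exact/v_lt.
split; first exact/v_lt.
move=> _ /R_v[j <-] /v_lt aj /v_lt jb; apply/VP; exists j => //.
by apply: abP; rewrite aj.
Qed.

Lemma tau_coord V k : V ∈ tau -> v k ∈ V ->
  exists a b, a < k < b /\ forall j, a < j < b -> v j ∈ V.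
Proof.
move=> /topology[_ openV] /openV[_ [/R_v[a <-] [_ [/R_v[b <-]]]]].
move=> [/v_lt ak [/v_lt kb abV]]; exists a, b; rewrite ak kb; split=> // j.
by move=> /andP[aj jb]; apply: abV; [apply: v_R|apply/v_lt|apply/v_lt].
Qed.

Lemma function_coord f : Function f X R -> exists g : M -> K,
  forall x y, Maps f x y <-> x ∈ X /\ y = v (g x).
Proof.
move=> fun_f; have [[_ f_ex] f_R] := fun_f.
have [|g gP] := @choice M K (fun x k => x ∈ X -> Maps f x (v k)).
  move=> x; have [xX|nxX] := pselect (x ∈ X); last by exists 0.
  have [y [fxy _]] := f_ex x xX.
  by have /R_v[k ky] := f_R x xX y fxy; exists k => _; rewrite ky.
exists g => x y; split=> [fxy|[xX ->]]; last exact: gP.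
have xX := maps_function_dom fun_f fxy; split=> //.
have [z [_ z_uniq]] := f_ex x xX.
by rewrite (z_uniq _ fxy) (z_uniq _ (gP x xX)).
Qed.


Definition SeparatingFunction A B f :=
  Function f X R /\ Continuous f mu tau /\ SubsFiber A f o /\ SubsFiber B f e.

Definition SeparatingFamily A B G :=
  FunctionOn G I /\
  (forall r, r ∈ I -> exists U F, MapsPair G r U F /\
     U ∈ mu /\ GClosed F mu X /\ Sub A U /\ Sub U F) /\
  (forall s, s ∈ I -> forall r, r ∈ I -> Maps lt s r -> forall Us Fs Ur Fr,
     MapsPair G s Us Fs -> MapsPair G r Ur Fr ->
     Sub Fs Ur /\ exists D, D ∈ mu /\ Setdiff D Ur Fs) /\
  (forall r, r ∈ I -> forall U F, MapsPair G r U F -> Disjoint F B).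

(** The sets [{f < r}] and [{f <= r}] exist by separation and the family by
    replacement; the members of [mu] are preimages under [f] of rays and
    intervals. *)
Lemma family_of_function A B f :
  SeparatingFunction A B f -> exists G, SeparatingFamily A B G.
Proof.
move=> [fun_f [cont_f [[Vo [PA [VoP [PAP sub_A]]]]]]].
move=> [Ve [PB [VeP [PBP sub_B]]]].
have [g gP] := function_coord fun_f.
have gA x : x ∈ A -> g x = 0.
  move=> /sub_A/PAP[y [/VoP yo /gP[_ yg]]]; apply: v_inj.
  by rewrite v0 -yg; case: yo.
have gB x : x ∈ B -> g x = 1.
  move=> /sub_B/PBP[y [/VeP ye /gP[_ yg]]]; apply: v_inj.
  by rewrite v1 -yg; case: ye.
have AX x : x ∈ A -> x ∈ X by move=> /sub_A/PAP[y [_ /gP[]]].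
pose rays (r w : M) := exists U F, Pair w U F /\
  (forall x, x ∈ U <-> x ∈ X /\ exists y, Maps f x y /\ Maps lt y r) /\
  (forall x, x ∈ F <-> x ∈ X /\ exists y, Maps f x y /\ Le lt y r).
have [G [fun_G GP]] : exists G, FunctionOn G I /\
    forall r, r ∈ I -> forall w, Maps G r w <-> rays r w.
  eapply (@function_ex [:: X; f; lt] _ rays).
    by rewrite /rays; solve_means.
  move=> r rI.
  have [U UP] : exists U, forall x, x ∈ U <->
      x ∈ X /\ exists y, Maps f x y /\ Maps lt y r.
    by eapply (separation (l := [:: f; lt; r])); solve_means.
  have [F FP] : exists F, forall x, x ∈ F <->
      x ∈ X /\ exists y, Maps f x y /\ Le lt y r.
    by eapply (separation (l := [:: f; lt; r])); solve_means.
  have [w wP] := pair_ex U F; exists w; split; first by exists U, F.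
  move=> w' [U' [F' [w'P [U'P F'P]]]]; apply: pair_eq w'P _.
  have -> : U' = U by apply: ext => x; rewrite (UP x) (U'P x).
  by have -> : F' = F by apply: ext => x; rewrite (FP x) (F'P x).
have levels k U F : v k ∈ I -> MapsPair G (v k) U F ->
    (forall x, x ∈ U <-> x ∈ X /\ g x < k) /\
    (forall x, x ∈ F <-> x ∈ X /\ g x <= k).
  move=> kI [w [wUF /(GP _ kI)[U' [F' [wUF' [U'P F'P]]]]]].
  have [? ?] := pair_inj wUF wUF'; subst U' F'.
  split=> x; rewrite ?U'P ?F'P.
    split=> [[xX [_ [/gP[_ ->] /v_lt]]]|[xX lt_gk]] //.
    by split=> //; exists (v (g x)); split; [apply/gP|apply/v_lt].
  split=> [[xX [_ [/gP[_ ->] /v_le]]]|[xX le_gk]] //.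
  by split=> //; exists (v (g x)); split; [apply/gP|apply/v_le].
have mu_of (P : K -> Prop) l p (Q' : M -> Prop) :
    (forall c y, means E c (y :: l) p (Q' y)) -> (forall k, Q' (v k) <-> P k) ->
    (forall k, P k -> exists a b, a < k < b /\ forall j, a < j < b -> P j) ->
    exists W, W ∈ mu /\ forall x, x ∈ W <-> x ∈ X /\ P (g x).
  move=> mQ QP openP; have [V VP] := separation R mQ.
  have V_tau : V ∈ tau.
    apply: open_coord openP => y; rewrite VP.
    split=> [[/R_v[k <-] /QP Pk]|[k <- Pk]].
      by exists k.
    by split; [exact: v_R|exact/QP].
  have [W [W_mu WP]] := cont_f V V_tau; exists W; split=> // x.
  rewrite (WP x); split=> [[y [/VP[_ Qy] /gP[xX yg]]]|[xX Pgx]].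
    by split=> //; apply/QP; rewrite -yg.
  by exists (v (g x)); split; [apply/VP; split; [exact: v_R|exact/QP]|apply/gP].
have below k : exists W, W ∈ mu /\ forall x, x ∈ W <-> x ∈ X /\ g x < k.
  eapply (mu_of (fun j => j < k) [:: v k; lt] _ (fun y => Maps lt y (v k))).
  - by solve_means.
  - by move=> j; apply: v_lt.
  - by move=> j lt_jk; exists (j - 1), k; split=> [|i /andP[]//]; lra.
have above k : exists W, W ∈ mu /\ forall x, x ∈ W <-> x ∈ X /\ k < g x.
  eapply (mu_of (fun j => k < j) [:: v k; lt] _ (fun y => Maps lt (v k) y)).
  - by solve_means.
  - by move=> j; apply: v_lt.
  - by move=> j lt_kj; exists k, (j + 1); split=> [|i /andP[]//]; lra.
have between i k :
    exists W, W ∈ mu /\ forall x, x ∈ W <-> x ∈ X /\ i < g x < k.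
  eapply (mu_of (fun j => i < j < k) [:: v i; v k; lt] _
    (fun y => Maps lt (v i) y /\ Maps lt y (v k))).
  - by solve_means.
  - by move=> j; split=> [[/v_lt -> /v_lt ->]|/andP[/v_lt ? /v_lt ?]].
  - by move=> j ijk; exists i, k.
exists G; split=> //; split; last split.
- move=> r rI; have [k rk] := I_v rI; subst r.
  have /v_I[_ /andP[k0 k1]] := rI.
  have [w [Gw _]] := fun_G.2 _ rI; have /(GP _ rI)[U [F [wUF _]]] := Gw.
  have GUF : MapsPair G (v k) U F by exists w.
  have [UP FP] := levels k U F rI GUF.
  exists U, F; split=> //; split.
    have [W [W_mu WP]] := below k.
    by suff -> : U = W by []; apply: ext => x; rewrite UP WP.
  split.
    split=> [x /FP[]//|]; have [C [C_mu CP]] := above k.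
    exists C; split=> // x; rewrite CP FP ltNge.
    by split=> [[xX /negP nle]|[xX nle]]; split=> //; [tauto|apply/negP; tauto].
  split=> x; first by move=> xA; apply/UP; rewrite gA //; split=> //; exact: AX.
  by move=> /UP[xX /ltW le]; apply/FP.
- move=> s sI r rI; have [i si] := I_v sI; have [k rk] := I_v rI; subst s r.
  move=> /v_lt lt_ik Us Fs Ur Fr.
  move=> /(levels i _ _ sI)[_ FsP] /(levels k _ _ rI)[UrP _].
  split=> [x /FsP[xX le]|].
    by apply/UrP; split=> //; apply: le_lt_trans lt_ik.
  have [W [W_mu WP]] := between i k; exists W; split=> // x.
  rewrite WP UrP FsP [i < _]ltNge.
  split=> [[xX /andP[/negP nle ->]]|[[xX ->] nle]].
    by split=> //; tauto.
  by split=> //; rewrite andbT; apply/negP; tauto.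
- move=> r rI; have [k rk] := I_v rI; subst r; have /v_I[_ /andP[_ k1]] := rI.
  move=> U F /(levels k _ _ rI)[_ FP] [x [/FP[_ le] /gB g1]].
  by move: le; rewrite g1 leNgt k1.
Qed.

(** The value at [x] is the least upper bound of [o] and of the indices [s] with
    [x] outside [F_s]. It is unique, so replacement applies and no choice is
    made. The lemmas on scales then apply to the subtype of elements of [X], with
    [K] as its own index set. *)
Lemma function_of_family A B G : Sub A X -> Sub B X ->
  SeparatingFamily A B G -> exists f, SeparatingFunction A B f.
Proof.
move=> sub_AX sub_BX [fun_G [G1 [G2 G3]]].
have G_uniq r U F U' F' : r ∈ I -> MapsPair G r U F -> MapsPair G r U' F' ->
    U = U' /\ F = F'.
  move=> rI [w [wP Gw]] [w' [w'P Gw']]; have [z [_ zP]] := fun_G.2 r rI.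
  by move: wP w'P; rewrite (zP _ Gw) (zP _ Gw'); apply: pair_inj.
pose bound x y := y ∈ R /\ Le lt o y /\
  forall s, s ∈ I -> forall U F, MapsPair G s U F -> ~ x ∈ F -> Le lt s y.
pose value x y := bound x y /\ forall z, bound x z -> Le lt y z.
have [f [fun_f fP]] : exists f, FunctionOn f X /\
    forall x, x ∈ X -> forall y, Maps f x y <-> value x y.
  eapply (@function_ex [:: R; o; I; G; lt] _ value).
    by rewrite /value /bound; solve_means.
  move=> x xX.
  have [S SP] : exists S, forall s, s ∈ S <-> s ∈ R /\
      (s = o \/ (s ∈ I /\ exists U F, MapsPair G s U F /\ ~ x ∈ F)).
    by eapply (separation (l := [:: o; I; G; x])); solve_means.
  have oS : o ∈ S by apply/SP; rewrite -v0; split; [exact: v_R|left].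
  have [|||y [yR [y_ub y_least]]] := completeR (S := S).
  - by move=> s /SP[].
  - by exists o.
  - exists e; rewrite -v1; split; first exact: v_R.
    move=> s /SP[_ [->|[sI _]]]; first by rewrite -v0; apply/v_le.
    have [i si] := I_v sI; subst s.
    by have /v_I[_ /andP[_ /ltW]] := sI; move/v_le.
  have least z : bound x z -> Le lt y z.
    move=> [zR [oz zP]]; apply: y_least => // s /SP[_ [->//|]].
    by move=> [sI [U [F [GUF nxF]]]]; apply: zP sI _ _ GUF nxF.
  have by_ : bound x y.
    split=> //; split; first exact: y_ub.
    move=> s sI U F GUF nxF; apply/y_ub/SP; split.
      by have [i <-] := I_v sI; apply: v_R.
    by right; split=> //; exists U, F.
  exists y; split=> // z [bz z_least].
  have [zR _] := bz; have /R_v[i yi] := yR; have /R_v[j zj] := zR.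
  have := least z bz; have := z_least y by_.
  rewrite -yi -zj => /v_le ji /v_le ij.
  by congr v; apply/eqP; rewrite eq_le ij ji.
have fun_fR : Function f X R.
  by split=> // x xX y /(fP _ xX)[[]].
have [g gP] := function_coord fun_fR.
have g_value x : x ∈ X -> value x (v (g x)) by move=> xX; apply/(fP _ xX)/gP.
pose XT := {x | x ∈ X}.
pose D := [set j | v j ∈ I].
pose u j : set XT := [set x | exists U F, MapsPair G (v j) U F /\ sval x ∈ U].
pose w j : set XT := [set x | exists U F, MapsPair G (v j) U F /\ sval x ∈ F].
pose h (x : XT) := g (sval x).
have u_E j U F : D j -> MapsPair G (v j) U F -> forall x, u j x <-> sval x ∈ U.
  move=> Dj GUF x; split=> [[U' [F' [GUF' xU]]]|xU]; last by exists U, F.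
  by have [-> _] := G_uniq _ _ _ _ _ Dj GUF GUF'.
have w_E j U F : D j -> MapsPair G (v j) U F -> forall x, w j x <-> sval x ∈ F.
  move=> Dj GUF x; split=> [[U' [F' [GUF' xF]]]|xF]; last by exists U, F.
  by have [_ ->] := G_uniq _ _ _ _ _ Dj GUF GUF'.
have D01 j : D j -> 0 < j < 1 by move=> /v_I[].
have sub_uw j : D j -> u j `<=` w j.
  move=> Dj x; have [U [F [GUF [_ [_ [_ sub_UF]]]]]] := G1 _ Dj.
  by move=> /(u_E _ _ _ Dj GUF)/sub_UF xF; apply/(w_E _ _ _ Dj GUF).
have sub_wu i j : D i -> D j -> i < j -> w i `<=` u j.
  move=> Di Dj /v_lt lt_ij x.
  have [Ui [Fi [GUFi _]]] := G1 _ Di; have [Uj [Fj [GUFj _]]] := G1 _ Dj.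
  have [sub_FU _] := G2 _ Di _ Dj lt_ij _ _ _ _ GUFi GUFj.
  by move=> /(w_E _ _ _ Di GUFi)/sub_FU ?; apply/(u_E _ _ _ Dj GUFj).
have h_ge0 x : 0 <= h x.
  by have [[_ [+ _]] _] := g_value _ (svalP x); rewrite -v0 => /v_le.
have h_ub x j : D j -> ~ w j x -> j <= h x.
  move=> Dj nwx; have [[_ [_ ub]] _] := g_value _ (svalP x).
  have [U [F [GUF _]]] := G1 _ Dj; apply/v_le/(ub _ Dj _ _ GUF).
  by move=> xF; apply/nwx/(w_E _ _ _ Dj GUF).
have h_least x y : 0 <= y -> (forall j, D j -> ~ w j x -> j <= y) -> h x <= y.
  move=> y0 y_ub; have [_ least] := g_value _ (svalP x); apply/v_le/least.
  split; first exact: v_R.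
  split; first by rewrite -v0; apply/v_le.
  move=> s sI U F; have [j sj] := I_v sI; subst s => GUF nxF.
  by apply/v_le/y_ub => // /(w_E _ _ _ sI GUF).
pose muT (W : set XT) := exists W', W' ∈ mu /\ forall x, W x <-> sval x ∈ W'.
have muT1 j : D j -> muT (u j) /\ muT (~` w j).
  move=> Dj; have [U [F [GUF [U_mu [[_ [C [C_mu CP]]] _]]]]] := G1 _ Dj.
  split; first by exists U; split=> // x; apply: u_E GUF _.
  exists C; split=> // x; rewrite (CP (sval x)) -(w_E _ _ _ Dj GUF).
  by split=> [?|[]//]; split=> //; exact: (svalP x).
have muT2 i j : D i -> D j -> i < j -> muT (u j `\` w i).
  move=> Di Dj /v_lt lt_ij.
  have [Ui [Fi [GUFi _]]] := G1 _ Di; have [Uj [Fj [GUFj _]]] := G1 _ Dj.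
  have [_ [W [W_mu WP]]] := G2 _ Di _ Dj lt_ij _ _ _ _ GUFi GUFj.
  exists W; split=> // x; rewrite (WP (sval x)) -(w_E _ _ _ Di GUFi).
  by rewrite -(u_E _ _ _ Dj GUFj).
have dense_D a b : 0 <= a -> a < b -> b <= 1 -> exists2 j, D j & a < j < b.
  exact: dense_I.
have fiber (S s : M) k : v k = s -> Sub S X ->
    (forall x : XT, sval x ∈ S -> h x = k) -> SubsFiber S f s.
  move=> ks sub_SX hS; have [V VP] := upair_ex s s.
  have [P PP] : exists P, forall x, x ∈ P <->
      x ∈ X /\ exists y, y ∈ V /\ Maps f x y.
    by eapply (separation (l := [:: V; f])); solve_means.
  exists V, P; split=> //; split=> x.
    rewrite PP; split=> [[]//|[y [yV fxy]]]; split; last by exists y.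
    by have /gP[] := fxy.
  move=> xS; have xX := sub_SX _ xS; apply/PP; split=> //.
  exists s; split; first by apply/VP; left.
  by apply/gP; split=> //; rewrite -ks -(hS (exist _ x xX) xS).
exists f; split=> //; split; last split.
- move=> V V_tau.
  (* The preimage of [V] is the union of all members of [mu] inside it. *)
  have [S SP] : exists S, forall W, W ∈ S <-> W ∈ mu /\
      forall x, x ∈ W -> exists y, y ∈ V /\ Maps f x y.
    by eapply (separation (l := [:: V; f])); solve_means.
  have [|P [P_mu PP]] := gtop.2 S; first by move=> W /SP[].
  exists P; split=> // x; rewrite PP; split=> [[W [/SP[_ WV] xW]]|[y [yV fxy]]].
    exact: WV.
  have [xX yg] := (gP x y).1 fxy; subst y.
  have [a [b [agb abV]]] := tau_coord V_tau yV.
  have [W [[W' [W'_mu W'P]] xW W_ab]] := scale_nbhs D01 dense_D sub_uw sub_wu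
    h_ge0 h_ub h_least (x := exist _ x xX) muT1 muT2 agb.
  exists W'; split; last exact: ((W'P (exist _ x xX)).1 xW).
  apply/SP; split=> // z zW'; have zX := gtop.1 _ W'_mu _ zW'.
  exists (v (g z)); split; last exact/gP.
  by apply: abV; apply: (W_ab (exist _ z zX)); apply: (W'P _).2.
- apply: (fiber _ _ 0) => // x xA.
  apply: (scale_eq0 D01 dense_D sub_uw sub_wu h_ge0 h_least) => j Dj.
  have [U [F [GUF [_ [_ [sub_AU _]]]]]] := G1 _ Dj.
  by apply/(u_E _ _ _ Dj GUF)/sub_AU.
- apply: (fiber _ _ 1) => // x xB.
  apply: (scale_eq1 D01 dense_D h_ge0 h_ub h_least) => j Dj.
  have [U [F [GUF _]]] := G1 _ Dj.
  by move=> /(w_E _ _ _ Dj GUF) xF; apply: (G3 _ Dj _ _ GUF); exists (sval x).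
Qed.

End Coordinates.

Theorem model_equivalence R pl ml o e lt Q I tau :
  Reals R pl ml o e lt -> Rationals Q R pl ml o e -> UnitInterval I Q lt o e ->
  UsualTopology tau R lt -> forall X mu, GTopology mu X ->
  forall A B, Sub A X -> Inhabited A -> Sub B X -> Inhabited B ->
  (exists f, SeparatingFunction R o e tau X mu A B f) <->
  (exists G, SeparatingFamily lt I X mu A B G).
Proof.
move=> realsR [subfieldQ _] intervalI topology X mu gtop A B sub_AX _ sub_BX _.
have [K [v [[v_inj R_v v0 v1] [v_pl v_ml v_lt]]]] := reals_coordinates realsR.
have completeR := realsR.2.2.
split=> [[f]|[G]].
  exact: (family_of_function v_inj R_v v0 v1 v_lt subfieldQ intervalI topology).
exact: (function_of_family v_inj R_v v0 v1 v_pl v_ml v_lt completeR subfieldQ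
  intervalI topology gtop sub_AX sub_BX).
Qed.

End Model.

#[local] Hint Resolve means_subs means_inhabited means_disjoint means_setdiff
means_union means_upair means_pair means_maps means_function_on means_function
means_preimage means_subs_fiber means_opr means_binop means_comm_assoc
means_field means_field_order means_le means_upper_bound means_complete
means_reals means_subfield means_rationals means_unit_interval
means_usual_topology means_gtopology means_gclosed means_continuous
means_maps_pair : means.

Local Open Scope classical_set_scope.
Local Open Scope ring_scope.

Theorem proposition4p1 :
  (forall (R : realType) (X : Type) (mu : set (set X)),
    generalized_topology mu ->
    forall A B : set X, A !=set0 -> B !=set0 ->
    (exists f : X -> R,
      [/\ gcontinuous mu f,
          A `<=` f @^-1` [set 0] & B `<=` f @^-1` [set 1]])
    <->
    (exists U F : rat -> set X,
      [/\ forall r : rat, 0 < r < 1 ->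
            [/\ mu (U r), gclosed mu (F r), A `<=` U r & U r `<=` F r],
          forall s r : rat, 0 < s < 1 -> 0 < r < 1 -> s < r ->
            F s `<=` U r /\ mu (U r `\` F s)
        & forall r : rat, 0 < r < 1 -> F r `&` B = set0]))
  /\
  ZF_proves (
    All R pl ml o e lt Q I tau,
      is_reals R pl ml o e lt ->
      is_rationals Q R pl ml o e ->
      is_rational_unit_interval I Q lt o e ->
      is_usual_topology tau R lt ->
    All X mu, is_gtopology mu X ->
    All A B, subs A X -> is_inhabited A -> subs B X -> is_inhabited B ->
    ((Ex f, is_function f X R /\ is_continuous f mu tau /\
        subs_fiber A f o /\ subs_fiber B f e)
     <->
     (Ex G, is_function_on G I /\
        (AllIn I of r, Ex U F, maps_pair G r U F /\
          U \in mu /\ is_gclosed F mu X /\ subs A U /\ subs U F) /\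
        (AllIn I of s r, maps lt s r -> All Us Fs Ur Fr,
          maps_pair G s Us Fs -> maps_pair G r Ur Fr ->
          subs Fs Ur /\ (ExIn mu of D, is_setdiff D Ur Fs)) /\
        (AllIn I of r, All U F, maps_pair G r U F -> are_disjoint F B))))%zf.
Proof.
split; first exact: real_equivalence.
apply: completeness => M E model_ZF rho.
apply: (sat_close _ (@model_equivalence M E model_ZF)).
by rewrite /SeparatingFunction /SeparatingFamily; solve_means.
Qed.
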